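(* For every $D\ge D_{\min}$, the capacity-distortion function of the bistatic ISAC channel satisfies $$C(D)\ \le\ \max_{P_{UX}:\ I(U,S;Z)\ge R_S(D)}\big\{ I(X;Y\mid U,S)+I(U,S;Z)\big\}-R_S(D),$$ where the maximum is over joint pmfs $P_{UX}$ of $X$ and an auxiliary random variable $U$ with finite alphabet, the joint distribution of $(S,U,X,Y,Z)$ is $P_{UX}P_SP_{YZ|XS}$, and $$R_S(D)=\min_{P_{\hat S|S}:\ \mathbb E[d(S,\hat S)]\le D} I(S;\hat S)$$ with $S\sim P_S$ and $\hat S$ taking values in $\hat{\mathcal S}$. (The maximum is understood as a supremum if it is not attained.)
   Context: Bistatic ISAC model. $\mathcal X,\mathcal S,\mathcal Y,\mathcal Z,\hat{\mathcal S}$ are finite sets, $P_S$ is a pmf on $\mathcal S$, $P_{YZ|XS}=p(y,z|x,s)$ is a conditional pmf on $\mathcal Y\times\mathcal Z$ given $(x,s)\in\mathcal X\times\mathcal S$, and $d:\mathcal S\times\hat{\mathcal S}\to\mathbb R_+$ is a (bounded) distortion function. The state sequence $S^n$ is i.i.d. $\sim P_S$ and independent of the message; the channel is memoryless: given $(x^n,s^n)$, $(Y^n,Z^n)$ has pmf $\prod_i p(y_i,z_i|x_i,s_i)$ (no feedback). The communication receiver observes $Y^n$ and knows $S^n$ (noncausally); the sensing receiver observes only $Z^n$ (it knows the codebook but not the message). A $(2^{nR},n)$ code consists of a message set $[1:2^{nR}]=\{1,\dots,\lceil 2^{nR}\rceil\}$, an encoder $w\mapsto x^n(w)\in\mathcal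 X^n$, a decoder $(y^n,s^n)\mapsto\hat w$, and a state estimator $h:\mathcal Z^n\to\hat{\mathcal S}^n$, $\hat S^n=h(Z^n)$. The message $W$ is uniform on the message set. $P_e^{(n)}=\Pr\{\hat W\ne W\}$ and $D^{(n)}=\frac1n\sum_{i=1}^n\mathbb E[d(S_i,\hat S_i)]$. A pair $(R,D)$ is achievable if there is a sequence of $(2^{nR},n)$ codes with $\lim_n P_e^{(n)}=0$ and $\limsup_n D^{(n)}\le D$. The capacity-distortion function is $C(D)=\max\{R\ge 0:(R,D)\text{ achievable}\}$. $D_{\min}$ is the minimum of $\mathbb E[d(S,\hat s(Z))]$ over all pmfs $P_X$ on $\mathcal X$ and all maps $\hat s:\mathcal Z\to\hat{\mathcal S}$, with $(X,S,Y,Z)\sim P_XP_SP_{YZ|XS}$. Information quantities are in bits. *)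

(* Defs.v *)
From HB Require Import structures.
From mathcomp Require Export all_boot all_order all_algebra.
From mathcomp Require Export all_classical all_reals all_analysis.
Export Order.TTheory GRing.Theory Num.Theory.
Export numFieldNormedType.Exports.

Set Implicit Arguments.
Unset Strict Implicit.
Unset Printing Implicit Defensive.

Local Open Scope classical_set_scope.
Local Open Scope ring_scope.

Definition is_pmf (R : realType) (T : finType) (P : T -> R) : Prop :=
  (forall t, 0 <= P t) /\ \sum_t P t = 1.

Definition prob (R : realType) (T : finType) (P : T -> R) (E : pred T) : R :=
  \sum_(t | E t) P t.

Definition expect (R : realType) (T : finType) (P : T -> R) (f : T -> R) : R :=
  \sum_t P t * f t.

(* Random variables on the finite probability space (T, P) are functions
   on T; [law P f] is the pmf of f. *)
Definition law (R : realType) (T A : finType) (P : T -> R) (f : T -> A)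
    (a : A) : R :=
  prob P (fun t => f t == a).

(* Information in bits.  The conventions 0 log (0/q) = 0 hold because the
   logarithms below are always multiplied by the joint probability, and the
   denominators only vanish where that probability does. *)
Definition log2 (R : realType) (x : R) : R := ln x / ln 2.

Definition mutual_info (R : realType) (T A B : finType) (P : T -> R)
    (f : T -> A) (g : T -> B) : R :=
  \sum_a \sum_b
    law P (fun t => (f t, g t)) (a, b) *
    log2 (law P (fun t => (f t, g t)) (a, b) / (law P f a * law P g b)).

(* I(f; g | h) = E log [ p(a,b|c) / (p(a|c) p(b|c)) ]
               = E log [ p(a,b,c) p(c) / (p(a,c) p(b,c)) ] *)
Definition cond_mutual_info (R : realType) (T A B C : finType) (P : T -> R)
    (f : T -> A) (g : T -> B) (h : T -> C) : R :=
  \sum_a \sum_b \sum_c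
    law P (fun t => (f t, g t, h t)) (a, b, c) *
    log2 (law P (fun t => (f t, g t, h t)) (a, b, c) * law P h c /
          (law P (fun t => (f t, h t)) (a, c) *
           law P (fun t => (g t, h t)) (b, c))).

(* An (M, n) code; length-n sequences are finite functions on 'I_n, and the
   message set [1 : M] is represented by 'I_M. *)
Record code (X S Y Z Shat : finType) (M n : nat) := Code {
  encoder : 'I_M -> {ffun 'I_n -> X};
  decoder : {ffun 'I_n -> Y} -> {ffun 'I_n -> S} -> 'I_M;
  estimator : {ffun 'I_n -> Z} -> {ffun 'I_n -> Shat}
}.

(* Joint pmf of (W, S^n, Y^n, Z^n): W uniform, S^n i.i.d. and independent of
   W, memoryless channel without feedback. *)
Definition code_law (R : realType) (X S Y Z Shat : finType)
    (PS : S -> R) (PYZ : X -> S -> Y * Z -> R) (M n : nat)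
    (c : code X S Y Z Shat M n)
    (t : 'I_M * {ffun 'I_n -> S} * {ffun 'I_n -> Y} * {ffun 'I_n -> Z}) : R :=
  let '(w, s, y, z) := t in
  M%:R^-1 * (\prod_(i < n) PS (s i)) *
  \prod_(i < n) PYZ (encoder c w i) (s i) (y i, z i).

Definition error_prob (R : realType) (X S Y Z Shat : finType)
    (PS : S -> R) (PYZ : X -> S -> Y * Z -> R) (M n : nat)
    (c : code X S Y Z Shat M n) : R :=
  prob (code_law PS PYZ c) (fun '(w, s, y, z) => decoder c y s != w).

Definition distortion (R : realType) (X S Y Z Shat : finType)
    (PS : S -> R) (PYZ : X -> S -> Y * Z -> R) (d : S -> Shat -> R)
    (M n : nat) (c : code X S Y Z Shat M n) : R :=
  n%:R^-1 * \sum_(i < n)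
    expect (code_law PS PYZ c) (fun '(w, s, y, z) => d (s i) (estimator c z i)).

Definition num_messages (R : realType) (r : R) (n : nat) : nat :=
  `|Num.ceil (2 `^ (n%:R * r))|%N.

Definition achievable (R : realType) (X S Y Z Shat : finType)
    (PS : S -> R) (PYZ : X -> S -> Y * Z -> R) (d : S -> Shat -> R)
    (r D : R) : Prop :=
  exists c : forall n : nat, code X S Y Z Shat (num_messages r n) n,
    (fun n => error_prob PS PYZ (c n)) @ \oo --> (0 : R) /\
    (limn_esup (fun n => (distortion PS PYZ d (c n))%:E) <= D%:E)%E.

(* Suprema and infima are taken in the extended reals, so that none of the
   quantities below has a junk value when the feasible set is empty. *)
Definition capacity_distortion (R : realType) (X S Y Z Shat : finType)
    (PS : S -> R) (PYZ : X -> S -> Y * Z -> R) (d : S -> Shat -> R)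
    (D : R) : \bar R :=
  ereal_sup [set r%:E | r in [set r : R | 0 <= r /\
                                achievable PS PYZ d r D]].

Definition Dmin (R : realType) (X S Y Z Shat : finType)
    (PS : S -> R) (PYZ : X -> S -> Y * Z -> R) (d : S -> Shat -> R) : \bar R :=
  ereal_inf [set e : \bar R |
    exists (PX : X -> R) (shat : Z -> Shat),
      is_pmf PX /\
      e = (expect (fun '(x, s, y, z) => PX x * PS s * PYZ x s (y, z))
                  (fun '(x, s, y, z) => d s (shat z)))%:E].

Definition rate_distortion (R : realType) (S Shat : finType)
    (PS : S -> R) (d : S -> Shat -> R) (D : R) : \bar R :=
  ereal_inf [set e : \bar R |
    exists Q : S -> Shat -> R,
      let P := fun '(s, sh) => PS s * Q s sh in
      [/\ forall s, is_pmf (Q s),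
          expect P (fun '(s, sh) => d s sh) <= D &
          e = (mutual_info P fst snd)%:E]].

Definition single_letter_law (R : realType) (X S Y Z U : finType)
    (PS : S -> R) (PYZ : X -> S -> Y * Z -> R) (PUX : U * X -> R)
    (t : S * U * X * Y * Z) : R :=
  let '(s, u, x, y, z) := t in PUX (u, x) * PS s * PYZ x s (y, z).

Definition info_US_Z (R : realType) (X S Y Z U : finType)
    (PS : S -> R) (PYZ : X -> S -> Y * Z -> R) (PUX : U * X -> R) : R :=
  mutual_info (single_letter_law PS PYZ PUX)
    (fun '(s, u, x, y, z) => (u, s))
    (fun '(s, u, x, y, z) => z).

Definition info_X_Y_given_US (R : realType) (X S Y Z U : finType)
    (PS : S -> R) (PYZ : X -> S -> Y * Z -> R) (PUX : U * X -> R) : R :=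
  cond_mutual_info (single_letter_law PS PYZ PUX)
    (fun '(s, u, x, y, z) => x)
    (fun '(s, u, x, y, z) => y)
    (fun '(s, u, x, y, z) => (u, s)).

(* Main.v *)
Require Import Defs.
From mathcomp Require Import ring lra.

(* Fix a code and put U_i = (S^{n\i}, Y^{i-1}, Z_{i+1}^n).  Without feedback
   S_i is independent of (U_i, X_i) and U_i -> (X_i, S_i) -> (Y_i, Z_i), so
   (U_i, X_i) induces a single-letter law.  With
     Phi_i = H(S^n, Y_1 .. Y_i, Z_{i+1} .. Z_n)
   one gets, summing over i,
     sum_i [I(U_i,S_i;Z_i) + I(X_i;Y_i|U_i,S_i)]
       = sum_i H(Z_i) + sum_i [Phi_i - Phi_{i-1}] - sum_i H(Y_i|X_i,S_i)
       >= I(S^n;Z^n) + I(W;Y^n|S^n),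
   where the Phi_i telescope (this replaces the Csiszar sum identity); the sum
   of the I(U_i,S_i;Z_i) alone is at least I(S^n;Z^n).  Fano's inequality
   bounds I(W;Y^n|S^n) from below, and I(S^n;Z^n) >= n I(S;Shat) for the
   time-averaged law of (S_i, Shat_i).

   The time-shared laws satisfy the constraints of the theorem only up to a
   slack vanishing with n.  Caratheodory's theorem bounds the alphabet of U by
   |X| + 2, so that a compactness argument applied jointly to P_UX and to the
   law of (S, Shat) removes the slack; this also covers the boundary case where
   R_S(D) is the largest possible value of I(U,S;Z). *)

Set Implicit Arguments.
Unset Strict Implicit.
Unset Printing Implicit Defensive.

Local Open Scope classical_set_scope.
Local Open Scope ring_scope.

(** * Entropy on finite probability spaces *)

Section Entropy.
Variable R : realType.
Implicit Types (T A B C : finType).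

Lemma ln2_gt0 : 0 < ln (2 : R).
Proof. by rewrite ln_gt0 // ltr1n. Qed.

Lemma log2M (x y : R) : 0 < x -> 0 < y -> log2 (x * y) = log2 x + log2 y.
Proof. by move=> x0 y0; rewrite /log2 lnM ?posrE// mulrDl. Qed.

Lemma log2V (x : R) : 0 < x -> log2 x^-1 = - log2 x.
Proof. by move=> x0; rewrite /log2 lnV ?posrE// mulNr. Qed.

Lemma log2_div (x y : R) : 0 < x -> 0 < y -> log2 (x / y) = log2 x - log2 y.
Proof. by move=> x0 y0; rewrite log2M ?invr_gt0// log2V. Qed.

Lemma log2_1 : log2 (1 : R) = 0.
Proof. by rewrite /log2 ln1 mul0r. Qed.

Lemma log2_2 : log2 (2 : R) = 1.
Proof. by rewrite /log2 divff// gt_eqF// ln2_gt0. Qed.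

Lemma log2_prod (I : finType) (F : I -> R) :
  (forall i, 0 < F i) -> log2 (\prod_i F i) = \sum_i log2 (F i).
Proof.
move=> F0.
suff [] : 0 < \prod_i F i /\ log2 (\prod_i F i) = \sum_i log2 (F i) by [].
apply: (big_rec2 (fun x y => 0 < x /\ log2 x = y)); first by rewrite log2_1.
by move=> i y x _ [x0 xy]; rewrite mulr_gt0// log2M// xy.
Qed.

Lemma log2_le_subr1 (x : R) : 0 < x -> log2 x <= (x - 1) / ln 2.
Proof.
move=> x0; rewrite ler_pM2r ?invr_gt0 ?ln2_gt0//.
rewrite -[x in ln x](subrK 1) [x - 1 + 1]addrC le_ln1Dx//.
by rewrite ltrBrDl subrr.
Qed.

Definition eta (t : R) : R := t * log2 t.

Definition ent T A (P : T -> R) (f : T -> A) : R := - \sum_a eta (law P f a).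

Lemma law_ge0 T A (P : T -> R) (f : T -> A) a :
  (forall t, 0 <= P t) -> 0 <= law P f a.
Proof. by move=> P0; exact: sumr_ge0. Qed.

Lemma law_gt0 T A (P : T -> R) (f : T -> A) t :
  (forall t, 0 <= P t) -> 0 < P t -> 0 < law P f (f t).
Proof.
move=> P0 Pt; rewrite /law /prob (bigD1 t)//=.
by rewrite ltr_pwDl// sumr_ge0.
Qed.

Lemma expect_law T A (P : T -> R) (f : T -> A) (F : A -> R) :
  \sum_a law P f a * F a = \sum_t P t * F (f t).
Proof.
rewrite (partition_big f xpredT)//=; apply: eq_bigr => a _.
by rewrite /law /prob big_distrl/=; apply: eq_bigr => t /eqP ->.
Qed.

Lemma sum_law T A (P : T -> R) (f : T -> A) : \sum_a law P f a = \sum_t P t.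
Proof.
have := expect_law P f (fun=> 1).
by under eq_bigr do rewrite mulr1; under [RHS]eq_bigr do rewrite mulr1.
Qed.

Lemma lawE T A (P : T -> R) (f : T -> A) a :
  law P f a = \sum_t P t * (f t == a)%:R.
Proof.
rewrite /law /prob big_mkcond/=; apply: eq_bigr => t _.
by case: eqP; rewrite ?mulr1 ?mulr0.
Qed.

Lemma law_id A (P : A -> R) : law P id = P.
Proof. by apply/funext => a; rewrite /law /prob big_pred1_eq. Qed.

Lemma law_comp T A B (P : T -> R) (f : T -> A) (g : A -> B) :
  law (law P f) g = law P (g \o f).
Proof. by apply/funext => b; rewrite !lawE expect_law. Qed.

Lemma ent_comp T A B (P : T -> R) (f : T -> A) (g : A -> B) :
  ent (law P f) g = ent P (g \o f).
Proof. by rewrite /ent law_comp. Qed.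

Lemma entE T A (P : T -> R) (f : T -> A) :
  ent P f = - \sum_t P t * log2 (law P f (f t)).
Proof. by rewrite /ent /eta expect_law. Qed.

Lemma entNE T A (P : T -> R) (f : T -> A) :
  ent P f = \sum_t P t * - log2 (law P f (f t)).
Proof. by rewrite entE -sumrN; apply: eq_bigr => t _; rewrite mulrN. Qed.

(** Entropy sees only the partition into level sets. Tuples carrying the same information are
    identified through this, by comparing equality tests. *)
Lemma ent_ker T A B (P : T -> R) (f : T -> A) (g : T -> B) :
  (forall t t', (f t == f t') = (g t == g t')) -> ent P f = ent P g.
Proof.
move=> fg; rewrite !entE; congr -%R; apply: eq_bigr => t _.
by rewrite /law /prob; under eq_bigl do rewrite fg.
Qed.

(** Outcomes of probability zero contribute nothing, so the rules for [log2] have to be justified on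
    the support only. *)
Lemma eq_expect_supp T (P : T -> R) (F G : T -> R) :
  (forall t, 0 <= P t) -> (forall t, 0 < P t -> F t = G t) ->
  \sum_t P t * F t = \sum_t P t * G t.
Proof.
move=> P0 FG; apply: eq_bigr => t _.
have := P0 t; rewrite le_eqVlt => /orP[/eqP <-|/FG ->//].
by rewrite !mul0r.
Qed.

(** Nonnegativity of relative entropy, from [ln x <= x - 1]. The reference weight [r] may have less
    mass than [P], which admits subnormalised kernels later on. *)
Lemma gibbs T A (P : T -> R) (f : T -> A) (r : A -> R) :
  (forall t, 0 <= P t) -> (forall a, 0 <= r a) ->
  (forall t, 0 < P t -> 0 < r (f t)) ->
  \sum_a r a <= \sum_t P t ->
  ent P f <= - \sum_t P t * log2 (r (f t)).
Proof.
move=> P0 r0 rpos rle; rewrite entE lerN2 -subr_le0 -sumrB.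
under eq_bigr do rewrite -mulrBr.
pose F a := r a / law P f a.
apply: (@le_trans _ _ (\sum_t P t * ((F (f t) - 1) / ln 2))).
  apply: ler_sum => t _.
  have := P0 t; rewrite le_eqVlt => /orP[/eqP <-|Pt]; first by rewrite !mul0r.
  have pf := law_gt0 f P0 Pt.
  rewrite -log2_div ?rpos// ler_wpM2l ?P0// log2_le_subr1//.
  by rewrite divr_gt0 ?rpos.
under eq_bigr do rewrite mulrA mulrBr mulr1.
rewrite -big_distrl/= sumrB -expect_law.
rewrite pmulr_lle0 ?invr_gt0 ?ln2_gt0// subr_le0 (le_trans _ rle)//.
apply: ler_sum => a _; rewrite /F mulrCA.
(* Where [law P f a] vanishes the left side is 0, and [r a] is nonnegative. *)
have [->|n0] := eqVneq (law P f a) 0; first by rewrite mul0r mulr0.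
by rewrite divff// mulr1.
Qed.

Lemma sum_prod A B (F : A * B -> R) :
  \sum_p F p = \sum_a \sum_b F (a, b).
Proof.
rewrite (pair_big xpredT xpredT (fun a b => F (a, b)))/=.
by apply: eq_bigr => -[].
Qed.

Lemma law_fst A B (P : A * B -> R) : law P fst = fun a => \sum_b P (a, b).
Proof.
apply/funext => a; rewrite lawE sum_prod (bigD1 a)//= [X in _ + X]big1 ?addr0.
  by apply: eq_bigr => b _; rewrite eqxx mulr1.
by move=> a' /negbTE a'a; rewrite big1// => b _; rewrite a'a mulr0.
Qed.

Lemma sum_pair_law T A B (P : T -> R) (f : T -> A) (g : T -> B) b :
  \sum_a law P (fun t => (f t, g t)) (a, b) = law P g b.
Proof.
rewrite /law /prob (partition_big f xpredT)//=; apply: eq_bigr => a _.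
by apply: eq_bigl => t; rewrite xpair_eqE andbC.
Qed.

(** Gibbs' inequality against the weight that makes [f] and [g] conditionally independent given [h];
    this is [I(f; g | h) >= 0]. *)
Lemma ent_submod T A B C (P : T -> R) (f : T -> A) (g : T -> B) (h : T -> C) :
  (forall t, 0 <= P t) ->
  ent P (fun t => (f t, g t, h t)) + ent P h <=
  ent P (fun t => (f t, h t)) + ent P (fun t => (g t, h t)).
Proof.
move=> P0.
pose r (abc : A * B * C) := let: (a, b, c) := abc in
  law P (fun t => (f t, h t)) (a, c) * law P (fun t => (g t, h t)) (b, c) /
  law P h c.
have G : ent P (fun t => (f t, g t, h t)) <=
    - \sum_t P t * log2 (r (f t, g t, h t)).
  apply: gibbs => //.
  - by case=> [[a b] c]; rewrite /r divr_ge0 ?mulr_ge0// law_ge0.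
  - move=> t Pt; rewrite /r divr_gt0 ?mulr_gt0//.
    + exact: (law_gt0 (fun t => (f t, h t))).
    + exact: (law_gt0 (fun t => (g t, h t))).
    + exact: law_gt0.
  rewrite -(sum_law P h) sum_prod exchange_big/=; apply: ler_sum => c _.
  rewrite sum_prod /r.
  under eq_bigr do under eq_bigr do rewrite -mulrA.
  under eq_bigr do rewrite -big_distrr/= -big_distrl/= sum_pair_law.
  rewrite -big_distrl/= sum_pair_law.
  have [->|n0] := eqVneq (law P h c) 0; first by rewrite mul0r.
  by rewrite divff// mulr1.
rewrite (le_trans (lerD G (lexx _)))// !entE -!opprD lerN2 -!big_split/=.
rewrite le_eqVlt; apply/orP; left; apply/eqP.
under [LHS]eq_bigr do rewrite -mulrDr.
under [RHS]eq_bigr do rewrite -mulrDr.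
apply: eq_expect_supp => // t Pt.
have pfh := law_gt0 (fun t => (f t, h t)) P0 Pt.
have pgh := law_gt0 (fun t => (g t, h t)) P0 Pt.
have ph := law_gt0 h P0 Pt.
by rewrite /r log2_div ?mulr_gt0// log2M// subrK.
Qed.

Lemma mutual_infoE T A B (P : T -> R) (f : T -> A) (g : T -> B) :
  (forall t, 0 <= P t) ->
  mutual_info P f g = ent P f + ent P g - ent P (fun t => (f t, g t)).
Proof.
move=> P0; rewrite /mutual_info.
pose F ab := log2 (law P (fun t => (f t, g t)) ab /
                   (law P f ab.1 * law P g ab.2)).
rewrite -(sum_prod (fun ab => law P (fun t => (f t, g t)) ab * F ab)).
rewrite expect_law !entNE -big_split -sumrB/=.
under [RHS]eq_bigr do rewrite -mulrDr -mulrBr.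
apply: eq_expect_supp => // t Pt.
have pfg := law_gt0 (fun t => (f t, g t)) P0 Pt.
have pf := law_gt0 f P0 Pt.
have pg := law_gt0 g P0 Pt.
by rewrite /F/= log2_div ?mulr_gt0// log2M// opprK addrC opprD.
Qed.

Lemma cond_mutual_infoE T A B C (P : T -> R)
    (f : T -> A) (g : T -> B) (h : T -> C) :
  (forall t, 0 <= P t) ->
  cond_mutual_info P f g h =
  ent P (fun t => (f t, h t)) + ent P (fun t => (g t, h t)) -
  ent P (fun t => (f t, g t, h t)) - ent P h.
Proof.
move=> P0; rewrite /cond_mutual_info.
pose F (abc : A * B * C) := log2 (
   law P (fun t => (f t, g t, h t)) abc * law P h abc.2 /
   (law P (fun t => (f t, h t)) (abc.1.1, abc.2) *
    law P (fun t => (g t, h t)) (abc.1.2, abc.2))).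
rewrite -(sum_prod (fun ab => \sum_c
  law P (fun t => (f t, g t, h t)) (ab, c) * F (ab, c))).
rewrite -(sum_prod (fun abc => law P (fun t => (f t, g t, h t)) abc * F abc)).
rewrite expect_law !entNE -big_split -!sumrB/=.
under [RHS]eq_bigr do rewrite -mulrDr -!mulrBr.
apply: eq_expect_supp => // t Pt.
have pfgh := law_gt0 (fun t => (f t, g t, h t)) P0 Pt.
have pfh := law_gt0 (fun t => (f t, h t)) P0 Pt.
have pgh := law_gt0 (fun t => (g t, h t)) P0 Pt.
have ph := law_gt0 h P0 Pt.
rewrite /F/= log2_div ?mulr_gt0// !log2M//; ring.
Qed.

End Entropy.

(** * Conic Caratheodory theorem *)

Lemma etaM (R : realType) (a b : R) : 0 <= a -> 0 <= b ->
  eta (a * b) = a * eta b + b * eta a.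
Proof.
rewrite !le_eqVlt => /orP[/eqP <-|a0] /orP[/eqP <-|b0];
  rewrite /eta ?(mul0r, mulr0, addr0)//.
rewrite log2M//; ring.
Qed.

Lemma lawZ (R : realType) (T A : finType) (P : T -> R) (f : T -> A) l a :
  law (fun t => l * P t) f a = l * law P f a.
Proof. by rewrite /law /prob big_distrr. Qed.

(** The correction, [eta l] times the total mass, does not involve [f], so it cancels in any
    combination of entropies whose coefficients sum to zero; [kappa] and [chi] are of this kind. *)
Lemma entZ (R : realType) (T A : finType) (P : T -> R) (f : T -> A) l :
  0 <= l -> (forall t, 0 <= P t) ->
  ent (fun t => l * P t) f = l * ent P f - eta l * \sum_t P t.
Proof.
move=> l0 P0; rewrite /ent mulrN -opprD; congr -%R.
rewrite -(sum_law P f) !big_distrr/= -big_split/=; apply: eq_bigr => a _.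
by rewrite lawZ etaM ?law_ge0// [eta l * _]mulrC.
Qed.

Section Caratheodory.
Variable R : realFieldType.

(* All points start with weight 1; moving along a linear dependency until the
   first weight vanishes discards a point. *)
Lemma caratheodory_step m k (V : 'M[R]_(k.+1, m)) : (m <= k)%N ->
  exists (j : 'I_k.+1) (l : 'I_k.+1 -> R),
    [/\ forall i, 0 <= l i, l j = 0 &
        forall w, \sum_i l i * V i w = \sum_i V i w].
Proof.
move=> mk.
have /rowV0Pn[c cV c0] : kermx V != 0.
  rewrite kermx_eq0 /row_free neq_ltn; apply/orP; left.
  by rewrite (leq_ltn_trans (rank_leq_col V)).
(* Up to sign the dependency has a positive entry; its largest entry then determines which weight
   vanishes first. *)
wlog [j cj] : c cV c0 / exists j, 0 < c 0 j.
  move=> IH; have /rV0Pn[j cj] := c0.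
  have [cj0|cj0] := ltP 0 (c 0 j); first by apply: (IH c) => //; exists j.
  apply: (IH (- c)); [by rewrite eqmx_opp|by rewrite oppr_eq0|exists j].
  by rewrite mxE oppr_gt0 lt_neqAle cj.
case: (@arg_maxP _ _ _ j xpredT (fun i => c 0 i)) => // i _ imax.
have ci : 0 < c 0 i by apply: (lt_le_trans cj); exact: imax.
exists i, (fun i' => 1 - c 0 i' / c 0 i); split.
- by move=> i'; rewrite subr_ge0 ler_pdivrMr// mul1r; exact: imax.
- by rewrite divff ?subrr// gt_eqF.
move=> w; under eq_bigr do rewrite mulrBl mul1r.
rewrite sumrB [X in _ - X](_ : _ = 0) ?subr0//.
under eq_bigr do rewrite mulrAC.
rewrite -big_distrl/=.
have /sub_kermxP/matrixP/(_ 0 w) := cV.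
by rewrite !mxE => ->; rewrite mul0r.
Qed.

Definition homogeneous (X : Type) (phi : (X -> R) -> R) :=
  forall l q, 0 <= l -> (forall x, 0 <= q x) ->
    phi (fun x => l * q x) = l * phi q.

Lemma homogeneous0 (X : Type) (phi : (X -> R) -> R) :
  homogeneous phi -> phi (fun=> 0) = 0.
Proof.
move=> /(_ 0 (fun=> 0) (lexx _) (fun=> lexx _)) E.
rewrite -[RHS](mul0r (phi (fun=> 0))) -E.
by congr phi; apply/funext => x; rewrite mul0r.
Qed.

(** Short families are padded with zero weights, on which homogeneous functionals vanish. Long ones
    lose one point at a time by [caratheodory_step], whose new weights are absorbed into the points
    by homogeneity. *)
Lemma caratheodory_ord (X : Type) (W : finType) (phi : W -> (X -> R) -> R)
    (hphi : forall w, homogeneous (phi w)) k (q : 'I_k -> X -> R) :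
  (forall u x, 0 <= q u x) ->
  exists q' : 'I_#|W| -> X -> R, (forall u x, 0 <= q' u x) /\
    forall w, \sum_u phi w (q' u) = \sum_u phi w (q u).
Proof.
move=> q0; have [kW|Wk] := leqP k #|W|.
  rewrite -(subnK kW); move: (_ - _)%N => d.
  elim: d => [|d [q' [q'0 q'E]]]; first by exists q.
  exists (fun i : 'I_(d + k).+1 => if unlift ord0 i is Some i' then q' i' else fun=> 0).
  split=> [u x|w]; first by case: unlift.
  rewrite big_ord_recl unlift_none homogeneous0// add0r -q'E.
  by apply: eq_bigr => i _; rewrite liftK.
elim: k Wk q q0 => // k IH Wk q q0.
pose V := \matrix_(i < k.+1, j < #|W|) phi (enum_val j) (q i).
have [j [l [l0 lj lV]]] := caratheodory_step V Wk.
pose q1 (i : 'I_k) x := l (lift j i) * q (lift j i) x.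
have q10 u x : 0 <= q1 u x by rewrite mulr_ge0.
have q1E w : \sum_u phi w (q1 u) = \sum_u phi w (q u).
  have := lV (enum_rank w); rewrite (bigD1_ord j)//= lj mul0r add0r.
  under [RHS]eq_bigr do rewrite mxE enum_rankK.
  move=> <-; apply: eq_bigr => i _.
  by rewrite mxE enum_rankK /q1 hphi.
have [Wk1|kW] := ltnP #|W| k.
  have [q' [q'0 q'E]] := IH Wk1 q1 q10.
  by exists q'; split=> // w; rewrite q'E.
have kE : k = #|W| by apply/eqP; rewrite eqn_leq kW -ltnS.
by rewrite -kE; exists q1.
Qed.

Lemma caratheodory (X : Type) (W U : finType) (phi : W -> (X -> R) -> R)
    (hphi : forall w, homogeneous (phi w)) (q : U -> X -> R) :
  (forall u x, 0 <= q u x) ->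
  exists q' : 'I_#|W| -> X -> R, (forall u x, 0 <= q' u x) /\
    forall w, \sum_u phi w (q' u) = \sum_u phi w (q u).
Proof.
move=> q0.
have [q' [q'0 q'E]] :=
  caratheodory_ord hphi (fun (i : 'I_#|U|) => q0 (enum_val i)).
exists q'; split=> // w; rewrite q'E.
by rewrite -(big_enum_val (fun u => phi w (q u))).
Qed.

End Caratheodory.

(** * Single-letter information quantities *)

Section SingleLetter.
Variables (R : realType) (X S Y Z : finType).
Variables (PS : S -> R) (PYZ : X -> S -> Y * Z -> R).
Hypotheses (PS0 : forall s, 0 <= PS s) (PYZ0 : forall x s yz, 0 <= PYZ x s yz).

(** For [q = PUX (u, .)] this is the slice [U = u] of [single_letter_law], left unnormalised so that
    there is no division by the probability of [u]. *)
Definition slq (q : X -> R) (t : S * X * Y * Z) : R :=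
  let '(s, x, y, z) := t in q x * PS s * PYZ x s (y, z).

Definition rvS (t : S * X * Y * Z) := t.1.1.1.
Definition rvZ (t : S * X * Y * Z) := t.2.
Definition rvSZ (t : S * X * Y * Z) := (t.1.1.1, t.2).
Definition rvXS (t : S * X * Y * Z) := (t.1.1.2, t.1.1.1).
Definition rvYS (t : S * X * Y * Z) := (t.1.2, t.1.1.1).
Definition rvXYS (t : S * X * Y * Z) := (t.1.1.2, t.1.2, t.1.1.1).

(* [kappa q_u] is the contribution of [U = u] to [- H(Z | U, S)], and
   [chi q_u] its contribution to [I(X; Y | U, S)]; here [q_u] is the
   unnormalised weight [P_UX (u, .)], so that both are homogeneous. *)
Definition kappa (q : X -> R) := ent (slq q) rvS - ent (slq q) rvSZ.
Definition chi (q : X -> R) :=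
  ent (slq q) rvXS + ent (slq q) rvYS - ent (slq q) rvXYS - ent (slq q) rvS.

Lemma slq_ge0 q t : (forall x, 0 <= q x) -> 0 <= slq q t.
Proof. by move=> q0; case: t => [[[s x] y] z]; rewrite /slq !mulr_ge0. Qed.

Lemma slqZ l q : slq (fun x => l * q x) = (fun t => l * slq q t).
Proof. by apply/funext => -[[[s x] y] z]; rewrite /slq !mulrA. Qed.

Lemma kappa_homogeneous : homogeneous kappa.
Proof.
move=> l q l0 q0; have s0 t := slq_ge0 t q0.
rewrite /kappa slqZ !entZ//; ring.
Qed.

Lemma chi_homogeneous : homogeneous chi.
Proof.
move=> l q l0 q0; have s0 t := slq_ge0 t q0.
rewrite /chi slqZ !entZ//; ring.
Qed.

Variable U : finType.

Lemma law_single_letter (PUX : U * X -> R) (A : finType)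
    (g : S * X * Y * Z -> A) u a :
  law (single_letter_law PS PYZ PUX)
    (fun t => (t.1.1.1.2, g (t.1.1.1.1, t.1.1.2, t.1.2, t.2))) (u, a) =
  law (slq (fun x => PUX (u, x))) g a.
Proof.
rewrite !lawE !sum_prod/=; apply: eq_bigr => s _.
rewrite (bigD1 u)//= [X in _ + X]big1 ?addr0; last first.
  move=> u' u'u; do 3 (rewrite big1// => ? _).
  by rewrite xpair_eqE (negbTE u'u) mulr0.
do 3 (apply: eq_bigr => ? _).
by rewrite xpair_eqE eqxx.
Qed.

(** [eta] acts atom by atom and the slices are unnormalised, so the entropy of a pair [(U, g)] is
    the plain sum over the slices. *)
Lemma ent_single_letter (PUX : U * X -> R) (A : finType)
    (g : S * X * Y * Z -> A) :
  ent (single_letter_law PS PYZ PUX)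
    (fun t => (t.1.1.1.2, g (t.1.1.1.1, t.1.1.2, t.1.2, t.2))) =
  \sum_u ent (slq (fun x => PUX (u, x))) g.
Proof.
rewrite /ent sum_prod -sumrN; apply: eq_bigr => u _.
by under eq_bigr do rewrite law_single_letter.
Qed.

Lemma law_single_letterZ (PUX : U * X -> R) :
  law (single_letter_law PS PYZ PUX) snd =
  law (slq (fun x => \sum_u PUX (u, x))) rvZ.
Proof.
apply/funext => z; rewrite !lawE !sum_prod/=; apply: eq_bigr => s _.
rewrite exchange_big; apply: eq_bigr => x _/=.
rewrite exchange_big; apply: eq_bigr => y _/=.
rewrite exchange_big; apply: eq_bigr => z' _/=.
by rewrite -!big_distrl.
Qed.

Lemma single_letter_ge0 (PUX : U * X -> R) t : (forall t, 0 <= PUX t) ->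
  0 <= single_letter_law PS PYZ PUX t.
Proof. by case: t => [[[[s u] x] y] z] P0; rewrite /= !mulr_ge0. Qed.

(** [I(U,S;Z)] as [H(Z) + H(U,S) - H(U,S,Z)]: the first term depends on [q] only through the
    marginal of [X], the rest is additive over [u]. *)
Definition sl_infoUSZ (q : U -> X -> R) :=
  ent (slq (fun x => \sum_u q u x)) rvZ + \sum_u kappa (q u).
Definition sl_infoXY (q : U -> X -> R) := \sum_u chi (q u).

Lemma info_US_ZE (PUX : U * X -> R) : (forall t, 0 <= PUX t) ->
  info_US_Z PS PYZ PUX = sl_infoUSZ (fun u x => PUX (u, x)).
Proof.
move=> P0; rewrite /info_US_Z mutual_infoE; last by move=> t; exact: single_letter_ge0.
rewrite /sl_infoUSZ /kappa sumrB -!ent_single_letter.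
have -> : ent (slq (fun x => \sum_u PUX (u, x))) rvZ =
          ent (single_letter_law PS PYZ PUX) snd.
  by rewrite /ent law_single_letterZ.
rewrite addrCA addrA; congr (_ + _ - _); apply: ent_ker;
  move=> [[[[s u] x] y] z] [[[[s' u'] x'] y'] z']//.
by rewrite !xpair_eqE andbA.
Qed.

Lemma info_X_YE (PUX : U * X -> R) : (forall t, 0 <= PUX t) ->
  info_X_Y_given_US PS PYZ PUX = sl_infoXY (fun u x => PUX (u, x)).
Proof.
move=> P0; rewrite /info_X_Y_given_US cond_mutual_infoE;
  last by move=> t; exact: single_letter_ge0.
rewrite /sl_infoXY /chi/= 2!sumrB big_split/= -!ent_single_letter.
congr (_ + _ - _ - _); apply: ent_ker;
  move=> [[[[s u] x] y] z] [[[[s' u'] x'] y'] z']; rewrite !xpair_eqE//.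
- by rewrite andbCA.
- by rewrite andbCA.
- by case: (u == u'); rewrite ?andbF ?andbT.
Qed.

End SingleLetter.

(** * Converse for a fixed code *)

Section Resampling.
Variables (R : realType) (n : nat) (B : finType) (k : 'I_n -> B -> R).
Hypothesis k1 : forall j, \sum_b k j b = 1.

Definition upd (C : finType) (a : {ffun 'I_n -> C}) i b :=
  [ffun j => if j == i then b else a j].

(* [(a, b) |-> (upd a i b, a i)] is an involution preserving the product
   weight, so the coordinate [i] may be replaced by an independent copy. *)
Lemma resample i (F : {ffun 'I_n -> B} -> R) (G : B -> R) :
  (forall a b, F (upd a i b) = F a) ->
  \sum_(a : {ffun 'I_n -> B}) (\prod_j k j (a j)) * (F a * G (a i)) =
  (\sum_(a : {ffun 'I_n -> B}) (\prod_j k j (a j)) * F a) * \sum_b k i b * G b.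
Proof.
move=> Fi.
pose H (p : {ffun 'I_n -> B} * B) :=
  (\prod_j k j (p.1 j)) * k i p.2 * F p.1 * G p.2.
pose phi (p : {ffun 'I_n -> B} * B) := (upd p.1 i p.2, p.1 i).
have phiK : involutive phi.
  move=> [a b]; rewrite /phi/= ffunE eqxx; congr pair.
  by apply/ffunP => j; rewrite !ffunE; case: eqP => // ->.
transitivity (\sum_p H (phi p)).
  rewrite sum_prod; apply: eq_bigr => a _.
  transitivity (\sum_b k i b * ((\prod_j k j (a j)) * (F a * G (a i)))).
    by rewrite -big_distrl/= k1 mul1r.
  apply: eq_bigr => b _; rewrite /H/= Fi.
  rewrite (bigD1 i)//= [in RHS](bigD1 i)//= ffunE eqxx.
  under [in RHS]eq_bigr => j /negbTE ji do rewrite ffunE ji.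
  ring.
transitivity (\sum_p H p); first by rewrite [RHS](reindex_inj (inv_inj phiK)).
rewrite sum_prod big_distrl/=.
apply: eq_bigr => a _; rewrite big_distrr/=; apply: eq_bigr => b _.
by rewrite /H/=; ring.
Qed.

End Resampling.

(** * Regrouping and masking of sequences *)

Section Zip3.
Variables (R : realType) (n : nat) (S Y Z : finType).

Definition ffst3 (a : {ffun 'I_n -> S * Y * Z}) := [ffun j => (a j).1.1].
Definition fsnd3 (a : {ffun 'I_n -> S * Y * Z}) := [ffun j => (a j).1.2].
Definition fthd3 (a : {ffun 'I_n -> S * Y * Z}) := [ffun j => (a j).2].

(** A single sequence of triples makes the weight one product over time indices, the form to which
    [resample] applies. *)
Lemma sum_zip3 (F : {ffun 'I_n -> S} -> {ffun 'I_n -> Y} ->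
    {ffun 'I_n -> Z} -> R) :
  \sum_s \sum_y \sum_z F s y z =
  \sum_(a : {ffun 'I_n -> S * Y * Z}) F (ffst3 a) (fsnd3 a) (fthd3 a).
Proof.
rewrite -(sum_prod (fun sy => \sum_z F sy.1 sy.2 z)).
rewrite -(sum_prod (fun syz => F syz.1.1 syz.1.2 syz.2)).
rewrite (reindex (fun a => (ffst3 a, fsnd3 a, fthd3 a)))//=.
exists (fun syz : {ffun 'I_n -> S} * {ffun 'I_n -> Y} * {ffun 'I_n -> Z} =>
  [ffun j => (syz.1.1 j, syz.1.2 j, syz.2 j)]).
  by move=> a _; apply/ffunP => j; rewrite !ffunE -!surjective_pairing.
by move=> [[s y] z] _; congr (_, _, _); apply/ffunP => j; rewrite !ffunE.
Qed.

End Zip3.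

Section Mask.
Variables (n : nat) (A : finType).

(** Hidden entries become [None] instead of being cut off, so that the subsequences for all time
    indices share a type and the [U_i] share an alphabet. *)
Definition mask_ffun (p : pred 'I_n) (a : {ffun 'I_n -> A}) :
  {ffun 'I_n -> option A} := [ffun j => if p j then Some (a j) else None].

Lemma mask_ffun_eq p a b :
  (mask_ffun p a == mask_ffun p b) = [forall j, p j ==> (a j == b j)].
Proof.
apply/eqP/forallP => [/ffunP ab j|ab].
  apply/implyP => pj; have := ab j; rewrite !ffunE pj => -[->]//.
apply/ffunP => j; rewrite !ffunE; case: ifP => // pj.
by have := ab j; rewrite pj => /eqP ->.
Qed.

Lemma ffun_eq_forall (a b : {ffun 'I_n -> A}) :
  (a == b) = [forall j, a j == b j].
Proof.
apply/eqP/forallP => [-> //|ab].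
by apply/ffunP => j; apply/eqP.
Qed.

Lemma mask_ffun_upd (p : pred 'I_n) a i b : ~~ p i ->
  mask_ffun p (upd a i b) = mask_ffun p a.
Proof.
move=> pi; apply/ffunP => j; rewrite !ffunE; case: ifP => // pj.
by case: eqP pj pi => // -> ->.
Qed.

Lemma mask_ffun_add (p q : pred 'I_n) i a b :
  (forall j, q j = (j == i) || p j) ->
  (mask_ffun p a == mask_ffun p b) && (a i == b i) =
  (mask_ffun q a == mask_ffun q b).
Proof.
move=> qE; rewrite !mask_ffun_eq; apply/andP/forallP => [[/forallP ab abi] j|ab].
  by rewrite qE; have [->|_] := eqVneq j i; [rewrite abi|exact: ab].
split; last by have := ab i; rewrite qE eqxx.
by apply/forallP => j; have := ab j; rewrite qE; case: (p j); rewrite ?orbT.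
Qed.

Lemma mask_ffunT (p : pred 'I_n) a b : (forall j, p j) ->
  (mask_ffun p a == mask_ffun p b) = (a == b).
Proof.
move=> pT; rewrite mask_ffun_eq ffun_eq_forall.
by apply: eq_forallb => j; rewrite pT.
Qed.

Lemma mask_ffun0 (p : pred 'I_n) a b : (forall j, ~~ p j) ->
  (mask_ffun p a == mask_ffun p b).
Proof.
by move=> p0; rewrite mask_ffun_eq; apply/forallP => j; rewrite (negbTE (p0 j)).
Qed.

End Mask.

(** * A fixed code: its law and the marginals of that law *)

Section CodeConverse.
Variables (R : realType) (X S Y Z Shat : finType).
Variables (PS : S -> R) (PYZ : X -> S -> Y * Z -> R) (d : S -> Shat -> R).
Hypotheses (hPS : is_pmf PS) (hPYZ : forall x s, is_pmf (PYZ x s)).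
Variables (M n : nat) (c : code X S Y Z Shat M n).
Hypotheses (M0 : (0 < M)%N) (n0 : (0 < n)%N).

Let PS0 s : 0 <= PS s. Proof. exact: hPS.1. Qed.
Let PYZ0 x s yz : 0 <= PYZ x s yz. Proof. exact: (hPYZ x s).1. Qed.

Local Notation T := ('I_M * {ffun 'I_n -> S} * {ffun 'I_n -> Y} *
                     {ffun 'I_n -> Z})%type.
Local Notation P := (code_law PS PYZ c).

Definition PYm x s y := \sum_z PYZ x s (y, z).

Definition msg (t : T) := t.1.1.1.
Definition state (t : T) := t.1.1.2.
Definition outY (t : T) := t.1.2.
Definition outZ (t : T) := t.2.
Definition inX (t : T) := encoder c (msg t).
Definition shat (t : T) := estimator c (outZ t).

Lemma PYm_ge0 x s y : 0 <= PYm x s y.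
Proof. exact: sumr_ge0. Qed.

Lemma sum_PYm x s : \sum_y PYm x s y = 1.
Proof. by rewrite -(hPYZ x s).2 sum_prod. Qed.

Lemma code_law_ge0 t : 0 <= P t.
Proof.
case: t => [[[w s] y] z]; rewrite /= !mulr_ge0 ?invr_ge0 ?ler0n//;
  exact: prodr_ge0.
Qed.

Definition kern (w : 'I_M) (j : 'I_n) (b : S * Y * Z) :=
  PS b.1.1 * PYZ (encoder c w j) b.1.1 (b.1.2, b.2).

Lemma sum_kern w j : \sum_b kern w j b = 1.
Proof.
rewrite sum_prod sum_prod -hPS.2; apply: eq_bigr => s _.
under eq_bigr do rewrite /kern/= -big_distrr/=.
by rewrite -big_distrr/= sum_PYm mulr1.
Qed.

Lemma sum_code_law (F : T -> R) :
  \sum_t P t * F t = \sum_w M%:R^-1 *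
    \sum_(a : {ffun 'I_n -> S * Y * Z})
      (\prod_j kern w j (a j)) * F (w, ffst3 a, fsnd3 a, fthd3 a).
Proof.
rewrite !sum_prod; apply: eq_bigr => w _.
rewrite (sum_zip3 (fun s y z => code_law PS PYZ c (w, s, y, z) * F (w, s, y, z))).
rewrite big_distrr/=; apply: eq_bigr => a _.
rewrite -!mulrA; congr (_ * _); rewrite mulrA; congr (_ * _).
rewrite -big_split/=; apply: eq_bigr => j _.
by rewrite /kern !ffunE.
Qed.

Lemma law_msg_state_outY : law P fst = fun t : 'I_M * _ * _ =>
  M%:R^-1 * (\prod_i PS (t.1.2 i)) *
  \prod_i PYm (encoder c t.1.1 i) (t.1.2 i) (t.2 i).
Proof.
rewrite law_fst; apply/funext => -[[w s] y]/=.
by rewrite -big_distrr/= bigA_distr_bigA.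
Qed.

Lemma law_msg_state : law P (fun t => t.1.1) =
  fun t : 'I_M * _ => M%:R^-1 * \prod_i PS (t.2 i).
Proof.
rewrite -(law_comp P fst fst) law_msg_state_outY law_fst.
apply/funext => -[w s]/=; rewrite -big_distrr/=.
rewrite -(bigA_distr_bigA (fun i y => PYm (encoder c w i) (s i) y))/=.
by rewrite [X in _ * X]big1 ?mulr1// => i _; rewrite sum_PYm.
Qed.

Lemma law_state : law P state = fun s => \prod_i PS (s i).
Proof.
rewrite -[state]/((fun ws : 'I_M * _ => ws.2) \o (fun t : T => t.1.1)) -law_comp.
rewrite law_msg_state; apply/funext => s.
rewrite lawE sum_prod exchange_big (bigD1 s)//= [X in _ + X]big1 ?addr0.
  under eq_bigr do rewrite eqxx mulr1.
  rewrite -big_distrl/= sumr_const card_ord -(mulr_natr M%:R^-1) mulVf ?mul1r//.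
  by rewrite pnatr_eq0 -lt0n.
by move=> s' /negbTE s's; rewrite big1// => w _; rewrite s's mulr0.
Qed.

Lemma code_law_sum1 : \sum_t P t = 1.
Proof.
rewrite -(sum_law P state) law_state.
rewrite -(bigA_distr_bigA (fun i s => PS s))/=.
by rewrite big1// => i _; rewrite hPS.2.
Qed.

(** * The auxiliary variable and the single-letter law it induces *)

Definition UT := ({ffun 'I_n -> option S} * {ffun 'I_n -> option Y} *
  {ffun 'I_n -> option Z})%type.

(* [None] marks the coordinates that [U_i] does not reveal. *)
Definition rvU (i : 'I_n) (t : T) : UT :=
  (mask_ffun (fun j => j != i) (state t), mask_ffun (fun j => j < i)%N (outY t),
   mask_ffun (fun j => i < j)%N (outZ t)).

Definition PUX (i : 'I_n) : UT * X -> R := law P (fun t => (rvU i t, inX t i)).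

Lemma PUX_ge0 i ux : 0 <= PUX i ux.
Proof. by apply: law_ge0; exact: code_law_ge0. Qed.

Definition rvAll (i : 'I_n) (t : T) :=
  (state t i, rvU i t, inX t i, outY t i, outZ t i).

(** Given the message, the triple at time [i] is drawn from [kern w i] independently of the other
    triples, and [U_i] and [X_i] do not read it; [resample] therefore factors it out. *)
Lemma law_rvAll i : law P (rvAll i) = single_letter_law PS PYZ (PUX i).
Proof.
apply/funext => -[[[[s u] x] y] z] /=; rewrite /PUX !lawE !sum_code_law.
rewrite big_distrl/= big_distrl/=; apply: eq_bigr => w _.
rewrite -!mulrA; congr (_ * _).
pose F (a : {ffun 'I_n -> S * Y * Z}) : R :=
  ((rvU i (w, ffst3 a, fsnd3 a, fthd3 a), encoder c w i) == (u, x))%:R.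
pose G (b : S * Y * Z) : R := (b == (s, y, z))%:R.
have Fi a b : F (upd a i b) = F a.
  rewrite /F /rvU/=.
  have -> : ffst3 (upd a i b) = upd (ffst3 a) i b.1.1.
    by apply/ffunP => j; rewrite !ffunE; case: eqP.
  have -> : fsnd3 (upd a i b) = upd (fsnd3 a) i b.1.2.
    by apply/ffunP => j; rewrite !ffunE; case: eqP.
  have -> : fthd3 (upd a i b) = upd (fthd3 a) i b.2.
    by apply/ffunP => j; rewrite !ffunE; case: eqP.
  by rewrite !mask_ffun_upd ?eqxx ?ltnn.
transitivity (\sum_(a : {ffun 'I_n -> S * Y * Z})
    (\prod_j kern w j (a j)) * (F a * G (a i))).
  apply: eq_bigr => a _; congr (_ * _).
  rewrite /F /G /rvAll -natrM mulnb !ffunE; congr (_%:R); congr nat_of_bool.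
  case: (a i) => [[s' y'] z']/=; rewrite !xpair_eqE/=.
  do !case: (_ == _) => //.
rewrite (resample (sum_kern w) G Fi) !mulr_suml; apply: eq_bigr => a _.
rewrite -!mulrA; congr (_ * _).
rewrite -[X in _ = X * _]/(F a) /F.
case: eqP => [[_ <-]|_]; last by rewrite !mul0r.
rewrite !mul1r (bigD1 (s, y, z))//= [X in _ + X]big1 ?addr0.
  by rewrite /G eqxx mulr1.
by move=> b /negbTE bs; rewrite /G bs mulr0.
Qed.


Lemma ent_slq_code i (A : finType) (g : S * X * Y * Z -> A) :
  \sum_u ent (slq PS PYZ (fun x => PUX i (u, x))) g =
  ent P (fun t => (rvU i t, g (state t i, inX t i, outY t i, outZ t i))).
Proof. by rewrite -ent_single_letter -law_rvAll ent_comp. Qed.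

Lemma sum_slq_code i (f : S * X * Y * Z -> R) :
  \sum_u \sum_r slq PS PYZ (fun x => PUX i (u, x)) r * f r =
  \sum_t P t * f (state t i, inX t i, outY t i, outZ t i).
Proof.
pose F (a : S * UT * X * Y * Z) := f (a.1.1.1.1, a.1.1.2, a.1.2, a.2).
transitivity (\sum_a law P (rvAll i) a * F a); last by rewrite expect_law.
rewrite law_rvAll; do 4 rewrite [RHS]sum_prod.
rewrite [RHS]exchange_big; apply: eq_bigr => u _.
by rewrite !sum_prod.
Qed.

Lemma law_rvXYS (q : X -> R) :
  law (slq PS PYZ q) (@rvXYS X S Y Z) =
  fun a => q a.1.1 * PS a.2 * PYm a.1.1 a.2 a.1.2.
Proof.
apply/funext => -[[x y] s]/=; rewrite lawE !sum_prod.
rewrite (bigD1 s)//= [X in _ + X]big1 ?addr0; last first.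
  move=> s' /negbTE ss; do 3 (rewrite big1// => ? _).
  by rewrite !xpair_eqE/= ss andbF mulr0.
rewrite (bigD1 x)//= [X in _ + X]big1 ?addr0; last first.
  move=> x' /negbTE xx; do 2 (rewrite big1// => ? _).
  by rewrite !xpair_eqE/= xx mulr0.
rewrite (bigD1 y)//= [X in _ + X]big1 ?addr0; last first.
  move=> y' /negbTE yy; rewrite big1// => ? _.
  by rewrite !xpair_eqE/= yy andbF mulr0.
rewrite big_distrr/=; apply: eq_bigr => z _.
by rewrite eqxx mulr1.
Qed.

Lemma law_rvXS (q : X -> R) :
  law (slq PS PYZ q) (@rvXS X S Y Z) = fun a => q a.1 * PS a.2.
Proof.
rewrite -[@rvXS X S Y Z]/((fun a : X * Y * S => (a.1.1, a.2)) \o @rvXYS X S Y Z).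
rewrite -law_comp law_rvXYS; apply/funext => -[x s]/=; rewrite lawE !sum_prod.
rewrite (bigD1 x)//= [X in _ + X]big1 ?addr0; last first.
  move=> x' /negbTE xx; do 2 (rewrite big1// => ? _).
  by rewrite !xpair_eqE/= xx mulr0.
rewrite exchange_big (bigD1 s)//= [X in _ + X]big1 ?addr0; last first.
  move=> s' /negbTE ss; rewrite big1// => ? _.
  by rewrite !xpair_eqE/= ss andbF mulr0.
under eq_bigr do rewrite eqxx mulr1.
by rewrite -big_distrr/= sum_PYm mulr1.
Qed.

(** The law of [(X, Y, S)] is that of [(X, S)] times [PYm], so [H(X,Y,S) - H(X,S)] is the mean of
    [- log2 PYm]. This isolates the channel entropy. *)
Lemma chiE (q : X -> R) : (forall x, 0 <= q x) ->
  chi PS PYZ q = ent (slq PS PYZ q) (@rvYS X S Y Z) -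
    ent (slq PS PYZ q) (@rvS X S Y Z) -
    \sum_r slq PS PYZ q r * - log2 (PYm r.1.1.2 r.1.1.1 r.1.2).
Proof.
move=> q0; rewrite /chi.
suff -> : ent (slq PS PYZ q) (@rvXYS X S Y Z) = ent (slq PS PYZ q) (@rvXS X S Y Z) +
    \sum_r slq PS PYZ q r * - log2 (PYm r.1.1.2 r.1.1.1 r.1.2) by ring.
have slq0 r : 0 <= slq PS PYZ q r by exact: slq_ge0.
rewrite !entNE -big_split/=; under [RHS]eq_bigr do rewrite -mulrDr.
apply: eq_expect_supp => // r r0; rewrite -opprD -log2M.
- by rewrite law_rvXYS law_rvXS; case: r r0 => [[[s x] y] z].
- exact: law_gt0.
have := law_gt0 (@rvXYS X S Y Z) slq0 r0; rewrite law_rvXYS/=.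
case: r {r0} => [[[s x] y] z]/= r0.
rewrite lt_neqAle PYm_ge0 andbT; apply/eqP => E; move: r0.
by rewrite -E mulr0 ltxx.
Qed.

(** * Telescoping entropies along the block *)

Definition eY (i : 'I_n) :=
  \sum_t P t * - log2 (PYm (inX t i) (state t i) (outY t i)).

Definition Phi (k : nat) := ent P (fun t => (state t,
  mask_ffun (fun j => j < k)%N (outY t), mask_ffun (fun j => k <= j)%N (outZ t))).
Definition Psi (k : nat) := ent P (fun t => (state t,
  mask_ffun (fun j => k <= j)%N (outZ t))).
Definition Gam (i : 'I_n) := ent P (fun t => (state t,
  mask_ffun (fun j => j < i)%N (outY t), mask_ffun (fun j => i < j)%N (outZ t))).

Lemma mask_state i t t' :
  (mask_ffun (fun j => j != i) (state t) == mask_ffun (fun j => j != i) (state t'))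
    && (state t i == state t' i) = (state t == state t').
Proof.
rewrite (@mask_ffun_add _ _ _ predT); last by move=> j /=; case: eqP.
by rewrite mask_ffunT.
Qed.

Lemma mask_outY (i : 'I_n) t t' :
  (mask_ffun (fun j => j < i)%N (outY t) == mask_ffun (fun j => j < i)%N (outY t'))
    && (outY t i == outY t' i) =
  (mask_ffun (fun j => j < i.+1)%N (outY t) == mask_ffun (fun j => j < i.+1)%N (outY t')).
Proof.
by rewrite (@mask_ffun_add _ _ _ (fun j => j < i.+1)%N)// => j; rewrite ltnS leq_eqVlt.
Qed.

Lemma mask_outZ (i : 'I_n) t t' :
  (mask_ffun (fun j => i < j)%N (outZ t) == mask_ffun (fun j => i < j)%N (outZ t'))
    && (outZ t i == outZ t' i) =
  (mask_ffun (fun j => i <= j)%N (outZ t) == mask_ffun (fun j => i <= j)%N (outZ t')).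
Proof.
rewrite (@mask_ffun_add _ _ _ (fun j => i <= j)%N)// => j.
by rewrite leq_eqVlt eq_sym.
Qed.

Lemma ent_US i : ent P (fun t => (rvU i t, state t i)) = Gam i.
Proof.
apply: ent_ker => t t'; rewrite !xpair_eqE -(mask_state i).
by do !case: (_ == _).
Qed.

(** Adjoining [Z_i] to [(U_i, S_i)] gives the variables of [Phi i]; adjoining [Y_i] instead gives
    those of [Phi i.+1], which is why the total telescopes. *)
Lemma sum_kappa_code i :
  \sum_u kappa PS PYZ (fun x => PUX i (u, x)) = Gam i - Phi i.
Proof.
rewrite /kappa sumrB !ent_slq_code ent_US; congr (_ - _); apply: ent_ker => t t'.
rewrite !xpair_eqE -(mask_state i) -mask_outZ.
by do !case: (_ == _).
Qed.

Lemma sum_chi_code i :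
  \sum_u chi PS PYZ (fun x => PUX i (u, x)) = Phi i.+1 - Gam i - eY i.
Proof.
under eq_bigr => u _ do rewrite (chiE (fun x => PUX_ge0 i (u, x))).
rewrite 2!sumrB !ent_slq_code ent_US sum_slq_code; congr (_ - _ - _).
apply: ent_ker => t t'.
rewrite !xpair_eqE -(mask_state i) -mask_outY.
by do !case: (_ == _).
Qed.

(** This is [I(Y^{i-1}; Z_i | S^n, Z_{i+1}^n) >= 0]. Dropping the past outputs from the conditioning
    leaves a sum that telescopes to [- H(Z^n | S^n)]. *)
Lemma Psi_Gam (i : 'I_n) : Psi i.+1 - Psi i <= Gam i - Phi i.
Proof.
have := ent_submod (fun t => mask_ffun (fun j => j < i)%N (outY t))
  (fun t => outZ t i)
  (fun t => (state t, mask_ffun (fun j => i < j)%N (outZ t))) code_law_ge0.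
rewrite [X in X + _ <= _ -> _](_ : _ = Phi i); last first.
  apply: ent_ker => t t'; rewrite !xpair_eqE -mask_outZ.
  by do !case: (_ == _).
rewrite [X in _ <= X + _ -> _](_ : _ = Gam i); last first.
  apply: ent_ker => t t'; rewrite !xpair_eqE.
  by do !case: (_ == _).
rewrite [X in _ <= _ + X -> _](_ : _ = Psi i); last first.
  apply: ent_ker => t t'; rewrite !xpair_eqE -mask_outZ.
  by do !case: (_ == _).
rewrite -/(Psi i.+1); lra.
Qed.

Lemma Phi0 : Phi 0 = ent P (fun t => (state t, outZ t)).
Proof.
apply: ent_ker => t t'; rewrite !xpair_eqE.
by rewrite mask_ffun0// andbT mask_ffunT.
Qed.

Lemma Phin : Phi n = ent P (fun t => (state t, outY t)).
Proof.
apply: ent_ker => t t'; rewrite !xpair_eqE.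
rewrite mask_ffunT; last by move=> j.
by rewrite mask_ffun0 ?andbT// => j; rewrite -ltnNge.
Qed.

Lemma Psi0 : Psi 0 = ent P (fun t => (state t, outZ t)).
Proof. by apply: ent_ker => t t'; rewrite !xpair_eqE mask_ffunT. Qed.

Lemma Psin : Psi n = ent P state.
Proof.
apply: ent_ker => t t'; rewrite !xpair_eqE.
by rewrite mask_ffun0 ?andbT// => j; rewrite -ltnNge.
Qed.

Lemma code_law_gt0 t : 0 < P t ->
  (forall i, 0 < PS (state t i)) /\
  (forall i, 0 < PYm (inX t i) (state t i) (outY t i)).
Proof.
move=> Pt.
have := law_gt0 fst code_law_ge0 Pt; rewrite law_msg_state_outY/=.
rewrite -mulrA -big_split/= => H.
have neq i : PS (state t i) * PYm (inX t i) (state t i) (outY t i) != 0.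
  apply/negP => /eqP E; move: H.
  by rewrite (bigD1 i)//= -/(state t) -/(inX t) E mul0r mulr0 ltxx.
split=> i; rewrite lt_neqAle ?PS0 ?PYm_ge0 eq_sym andbT;
  by have := neq i; rewrite mulf_eq0 negb_or => /andP[].
Qed.

Lemma ent_state : ent P state = \sum_t P t * \sum_i - log2 (PS (state t i)).
Proof.
rewrite entNE law_state; apply: eq_expect_supp; first exact: code_law_ge0.
by move=> t /code_law_gt0[S0 _]; rewrite log2_prod// sumrN.
Qed.

Lemma ent_msg_state :
  ent P (fun t => t.1.1) = log2 M%:R + ent P state.
Proof.
rewrite -[log2 _]mul1r -{1}code_law_sum1 mulr_suml ent_state entNE -big_split/=.
under [RHS]eq_bigr do rewrite -mulrDr.
rewrite law_msg_state; apply: eq_expect_supp; first exact: code_law_ge0.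
move=> t /code_law_gt0[S0 _]; rewrite log2M ?invr_gt0 ?ltr0n//.
  by rewrite log2V ?ltr0n// opprD opprK log2_prod// sumrN.
by apply: prodr_gt0 => i _; exact: S0.
Qed.

(** The channel is memoryless and without feedback, so [H(Y^n | W, S^n)] splits into the
    [H(Y_i | X_i, S_i)], which are the [eY i]. *)
Lemma ent_msg_state_outY :
  ent P fst = ent P (fun t => t.1.1) + \sum_i eY i.
Proof.
rewrite /eY exchange_big/= !entNE -big_split/=.
under [X in _ = \sum_i (_ + X i)]eq_fun do rewrite -big_distrr/=.
under [RHS]eq_bigr do rewrite -mulrDr.
rewrite law_msg_state law_msg_state_outY.
apply: eq_expect_supp; first exact: code_law_ge0.
move=> t /code_law_gt0[S0 Y0]; rewrite log2M.
- by rewrite opprD [in X in _ + X]log2_prod// sumrN.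
- rewrite mulr_gt0 ?invr_gt0 ?ltr0n//.
  by apply: prodr_gt0 => i _; exact: S0.
by apply: prodr_gt0 => i _; exact: Y0.
Qed.

(** * Fano's inequality *)

Local Notation Pe := (error_prob PS PYZ c).

(* Gibbs' inequality against the kernel that gives the decoded message weight
   1/2 and spreads the other 1/2 uniformly. *)
Lemma fano : ent P fst <=
  ent P (fun t => (state t, outY t)) + 1 + Pe * log2 M%:R.
Proof.
pose K (w : 'I_M) (s : {ffun 'I_n -> S}) (y : {ffun 'I_n -> Y}) : R :=
  if decoder c y s == w then 2^-1 else (2 * M%:R)^-1.
have M0R : 0 < M%:R :> R by rewrite ltr0n.
have K0 w s y : 0 < K w s y.
  by rewrite /K; case: ifP => _; rewrite invr_gt0// mulr_gt0.
have K1 s y : \sum_w K w s y <= 1.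
  rewrite (bigD1 (decoder c y s))//= {1}/K eqxx.
  rewrite [leRHS](splitr 1) mul1r.
  rewrite lerD2l (@le_trans _ _ (\sum_(w < M) (2 * M%:R)^-1))//.
    rewrite [leRHS](bigD1 (decoder c y s))//= -[leLHS]add0r lerD//.
    by apply: ler_sum => w /negbTE wd; rewrite /K eq_sym wd.
  rewrite sumr_const card_ord -(mulr_natr (2 * M%:R)^-1) invfM -mulrA mulVf ?mulr1//.
  by rewrite gt_eqF.
pose r (a : 'I_M * {ffun 'I_n -> S} * {ffun 'I_n -> Y}) :=
  law P (fun t => (state t, outY t)) (a.1.2, a.2) * K a.1.1 a.1.2 a.2.
(* [- log2 K] equals 1 when decoding succeeds and [1 + log2 M] when it fails, so its mean is
   [1 + Pe * log2 M]. *)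
have -> : ent P (fun t => (state t, outY t)) + 1 + Pe * log2 M%:R =
    - \sum_t P t * log2 (r t.1).
  have E1 : 1 = \sum_t P t * 1.
    by under eq_bigr do rewrite mulr1; rewrite code_law_sum1.
  rewrite {1}E1 /error_prob /prob [X in X * log2 _]big_mkcond/= mulr_suml entNE.
  rewrite -!big_split -sumrN/=; apply: eq_bigr => t _.
  have := code_law_ge0 t; rewrite le_eqVlt => /orP[/eqP Pt|Pt].
    by rewrite -Pt; case: t {Pt} => [[[w s] y] z]; case: ifP; rewrite !mul0r !addr0 oppr0.
  rewrite /r log2M//; last exact: (law_gt0 (fun t => (state t, outY t)) code_law_ge0).
  rewrite -/(state t) -/(outY t); set L := log2 (law _ _ _).
  case: t @L {Pt} => [[[w s] y] z] L; rewrite /K/=.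
  case: eqP => _/=; first by rewrite log2V// log2_2; ring.
  by rewrite log2V ?mulr_gt0// log2M// log2_2; ring.
apply: gibbs; first exact: code_law_ge0.
- by move=> a; rewrite mulr_ge0 ?(ltW (K0 _ _ _))// law_ge0//; exact: code_law_ge0.
- move=> t Pt; rewrite mulr_gt0//.
  exact: (law_gt0 (fun t => (state t, outY t)) code_law_ge0).
rewrite -(sum_law P (fun t => (state t, outY t))) [leLHS]sum_prod [leLHS]sum_prod.
rewrite [leRHS]sum_prod exchange_big/=; apply: ler_sum => s _.
rewrite exchange_big/=; apply: ler_sum => y _.
rewrite /r/= -big_distrr/= -[leRHS]mulr1 ler_wpM2l ?K1// law_ge0//.
exact: code_law_ge0.
Qed.

(** * Time averaging and the rate-distortion bound *)

Definition pZ (z : Z) := n%:R^-1 * \sum_i law P (fun t => outZ t i) z.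
Definition pSShat (a : S * Shat) :=
  n%:R^-1 * \sum_i law P (fun t => (state t i, shat t i)) a.

Let n0R : 0 < n%:R :> R. Proof. by rewrite ltr0n. Qed.

Lemma avg_law_ge0 (A : finType) (f : 'I_n -> T -> A) a :
  0 <= n%:R^-1 * \sum_(i < n) law P (f i) a.
Proof.
rewrite mulr_ge0 ?invr_ge0 ?ler0n ?sumr_ge0// => i _.
by apply: law_ge0; exact: code_law_ge0.
Qed.

Lemma avg_law_gt0 (A : finType) (f : 'I_n -> T -> A) i t : 0 < P t ->
  0 < n%:R^-1 * \sum_(j < n) law P (f j) (f i t).
Proof.
move=> Pt; rewrite mulr_gt0 ?invr_gt0// (bigD1 i)//= ltr_pwDl//.
  by apply: law_gt0 => //; exact: code_law_ge0.
by apply: sumr_ge0 => j _; apply: law_ge0; exact: code_law_ge0.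
Qed.

Lemma expect_avg_law (A : finType) (f : 'I_n -> T -> A) (F : A -> R) :
  n%:R * \sum_a (n%:R^-1 * \sum_(i < n) law P (f i) a) * F a =
  \sum_t P t * \sum_(i < n) F (f i t).
Proof.
rewrite big_distrr/=.
under eq_bigr do rewrite 2!mulrA divff ?gt_eqF// mul1r mulr_suml.
rewrite exchange_big/=; under eq_bigr do rewrite expect_law.
by rewrite exchange_big/=; apply: eq_bigr => t _; rewrite mulr_sumr.
Qed.

Lemma law_state_i i : law P (fun t => state t i) = PS.
Proof.
apply/funext => s.
transitivity (law (law P (rvAll i)) (fun a => a.1.1.1.1) s).
  by rewrite law_comp.
rewrite law_rvAll lawE !sum_prod (bigD1 s)//= [X in _ + X]big1 ?addr0; last first.
  move=> s' /negbTE ss; do 4 (rewrite big1// => ? _).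
  by rewrite ss mulr0.
pose F (ux : UT * X) := PS s * PUX i ux.
transitivity (\sum_ux F ux); last first.
  by rewrite -mulr_sumr sum_law code_law_sum1 mulr1.
rewrite [RHS]sum_prod; apply: eq_bigr => u _; apply: eq_bigr => x _.
rewrite /F/= -[RHS]mulr1 -[X in _ = _ * X](hPYZ x s).2 sum_prod mulr_sumr.
apply: eq_bigr => y _; rewrite mulr_sumr; apply: eq_bigr => z _.
by rewrite eqxx mulr1 [PS s * _]mulrC.
Qed.

Lemma pSShat_ge0 a : 0 <= pSShat a.
Proof. exact: (@avg_law_ge0 _ (fun i t => (state t i, shat t i))). Qed.

Lemma pSShat_fst : law pSShat fst = PS.
Proof.
rewrite law_fst; apply/funext => s; rewrite -mulr_sumr exchange_big/=.
have marg (i : 'I_n) :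
    \sum_h law P (fun t => (state t i, shat t i)) (s, h) = PS s.
  transitivity (law P (fun t => state t i) s); last by rewrite law_state_i.
  have -> : law P (fun t => state t i) =
      law (law P (fun t => (state t i, shat t i))) fst by rewrite law_comp.
  by rewrite law_fst.
under eq_bigr do rewrite marg.
by rewrite sumr_const card_ord -(mulr_natl (PS s)) mulrA mulVf ?mul1r// gt_eqF.
Qed.

Lemma pSShat_expect :
  expect pSShat (fun a => d a.1 a.2) = distortion PS PYZ d c.
Proof.
apply: (@mulfI _ n%:R); first by rewrite gt_eqF.
rewrite /distortion mulrA divff ?gt_eqF// mul1r /expect.
rewrite (expect_avg_law (fun i t => (state t i, shat t i)) (fun a => d a.1 a.2)).
rewrite [RHS]exchange_big/=; apply: eq_bigr => t _; rewrite mulr_sumr.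
by apply: eq_bigr => i _; case: t => [[[w s] y] z].
Qed.

Lemma pZ_sum : \sum_z pZ z = 1.
Proof.
rewrite -mulr_sumr exchange_big/=; under eq_bigr do rewrite sum_law code_law_sum1.
by rewrite sumr_const card_ord mulVf// gt_eqF.
Qed.

Lemma law_shat t i : 0 < P t -> 0 < law pSShat snd (shat t i).
Proof.
move=> Pt; have := avg_law_gt0 (fun i t => (state t i, shat t i)) i Pt.
exact: (law_gt0 snd pSShat_ge0).
Qed.

(* Gibbs' inequality against the product of [pZ (z_i)] and of the averaged
   backward channel from [Shat_i] to [S_i]. *)
Lemma mutual_info_pSShat :
  n%:R * (ent pSShat fst + ent pSShat snd - ent pSShat id) <=
  n%:R * (- \sum_z eta (pZ z)) + ent P state -
  ent P (fun t => (state t, outZ t)).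
Proof.
pose q (a : S * Shat) := pSShat a / law pSShat snd a.2.
pose r (a : {ffun 'I_n -> S} * {ffun 'I_n -> Z}) :=
  \prod_i (pZ (a.2 i) * q (a.1 i, estimator c a.2 i)).
have q0 a : 0 <= q a.
  by rewrite divr_ge0 ?pSShat_ge0// law_ge0//; exact: pSShat_ge0.
have pZ0 z : 0 <= pZ z by exact: (@avg_law_ge0 _ (fun i t => outZ t i)).
have pos t i : 0 < P t -> [/\ 0 < pZ (outZ t i),
    0 < pSShat (state t i, shat t i) & 0 < law pSShat snd (shat t i)].
  move=> Pt; split.
  - exact: (avg_law_gt0 (fun i t => outZ t i) i Pt).
  - exact: (avg_law_gt0 (fun i t => (state t i, shat t i)) i Pt).
  - exact: law_shat.
have G : ent P (fun t => (state t, outZ t)) <=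
    - \sum_t P t * log2 (r (state t, outZ t)).
  apply: gibbs; first exact: code_law_ge0.
  - by move=> a; apply: prodr_ge0 => i _; rewrite mulr_ge0.
  - move=> t Pt; apply: prodr_gt0 => i _; have [p1 p2 p3] := pos t i Pt.
    by rewrite mulr_gt0// divr_gt0.
  rewrite code_law_sum1 sum_prod exchange_big/=.
  (* For fixed [z] the estimates are fixed, so the sum over [s] factors over time; each factor is 1,
     or 0 when the estimate has averaged probability zero. *)
  apply: (@le_trans _ _ (\sum_(z : {ffun 'I_n -> Z}) \prod_i pZ (z i))).
    apply: ler_sum => z _; rewrite /r/=.
    under eq_bigr do rewrite big_split/=.
    rewrite -mulr_sumr -[leRHS]mulr1 ler_wpM2l ?prodr_ge0//.
    rewrite -(bigA_distr_bigA (fun i s => q (s, estimator c z i)))/=.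
    apply: prodr_ile1 => i _; apply/andP; split; first exact: sumr_ge0.
    rewrite /q/= -mulr_suml.
    rewrite (_ : \sum_s _ = law pSShat snd (estimator c z i)).
      by have [->|n0'] := eqVneq (law pSShat snd (estimator c z i)) 0;
        rewrite ?mul0r// divff.
    rewrite lawE sum_prod; apply: eq_bigr => s _.
    rewrite (bigD1 (estimator c z i))//= eqxx mulr1 big1 ?addr0//.
    by move=> h /negbTE ->; rewrite mulr0.
  rewrite -(bigA_distr_bigA (fun (i : 'I_n) z => pZ z))/=.
  by rewrite big1// => i _; exact: pZ_sum.
(* The logarithm of [r] splits over time. The [pZ] terms cancel, and [ent P state] supplies [n]
   times the entropy of [PS]. *)
suff E : n%:R * (ent pSShat fst + ent pSShat snd - ent pSShat id) =
    n%:R * (- \sum_z eta (pZ z)) + ent P state +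
    \sum_t P t * log2 (r (state t, outZ t)) by rewrite E; lra.
rewrite mulrBr mulrDr ent_state !entNE/= pSShat_fst -sumrN.
under [X in _ = _ * X + _ + _]eq_bigr do rewrite /eta -mulrN.
rewrite !(expect_avg_law (fun i t => (state t i, shat t i))).
rewrite (expect_avg_law (fun i t => outZ t i)) -2!big_split -sumrB -big_split/=.
under [LHS]eq_bigr do rewrite -mulrDr -mulrBr.
under [RHS]eq_bigr do rewrite -!mulrDr.
apply: eq_expect_supp; first exact: code_law_ge0.
move=> t Pt; rewrite /r/= log2_prod; last first.
  by move=> i; have [p1 p2 p3] := pos t i Pt; rewrite mulr_gt0// divr_gt0.
rewrite -!big_split -sumrB/=; apply: eq_bigr => i _.
have [p1 p2 p3] := pos t i Pt.
rewrite /q/= -/(shat t) (log2M p1) ?divr_gt0// (log2_div p2 p3).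
have -> : law pSShat id (state t i, shat t i) = pSShat (state t i, shat t i).
  by rewrite law_id.
ring.
Qed.

(** Time sharing: the auxiliary variable is the pair of a uniform time index and the value of [U_i]
    at that index. *)
Definition q_code (iu : 'I_n * UT) (x : X) := n%:R^-1 * PUX iu.1 (iu.2, x).

Lemma q_code_ge0 iu x : 0 <= q_code iu x.
Proof. by rewrite mulr_ge0 ?invr_ge0 ?ler0n// PUX_ge0. Qed.

Lemma sum_q_code : \sum_x \sum_iu q_code iu x = 1.
Proof.
rewrite exchange_big sum_prod.
rewrite (eq_bigr (fun=> n%:R^-1)); last first.
  move=> i _; rewrite /q_code -[RHS]mulr1 -[X in _ = _ * X]code_law_sum1.
  rewrite -(sum_law P (fun t => (rvU i t, inX t i))).
  rewrite [X in _ = _ * X]sum_prod mulr_sumr.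
  by apply: eq_bigr => u _; rewrite mulr_sumr.
by rewrite sumr_const card_ord -(mulr_natr n%:R^-1) mulVf// gt_eqF.
Qed.

Lemma sum_homogeneous_q_code (phi : (X -> R) -> R) : homogeneous phi ->
  n%:R * \sum_iu phi (q_code iu) = \sum_i \sum_u phi (fun x => PUX i (u, x)).
Proof.
move=> hphi; rewrite sum_prod mulr_sumr; apply: eq_bigr => i _.
rewrite mulr_sumr; apply: eq_bigr => u _.
rewrite (hphi n%:R^-1 (fun x => PUX i (u, x))) ?invr_ge0 ?ler0n//.
  by rewrite mulrA divff ?mul1r// gt_eqF.
by move=> x; exact: PUX_ge0.
Qed.

Lemma law_q_codeZ :
  law (slq PS PYZ (fun x => \sum_iu q_code iu x)) (@rvZ X S Y Z) = pZ.
Proof.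
apply/funext => z.
have lawZi i : law P (fun t => outZ t i) z =
    law (slq PS PYZ (fun x => \sum_u PUX i (u, x))) (@rvZ X S Y Z) z.
  by rewrite -law_single_letterZ -law_rvAll law_comp.
rewrite /pZ; under eq_bigr do rewrite lawZi lawE.
rewrite exchange_big mulr_sumr/= lawE; apply: eq_bigr => -[[[s x] y] z'] _.
rewrite -mulr_suml mulrA; congr (_ * _); rewrite /slq -!mulr_suml !mulrA.
do 2 congr (_ * _); rewrite sum_prod mulr_sumr; apply: eq_bigr => i _.
by rewrite mulr_sumr.
Qed.

(** The first bound telescopes [Psi], the second telescopes [Phi] and uses [fano]. In both,
    [mutual_info_pSShat] controls the information between state and estimate. *)
Lemma code_converse :
  n%:R * (ent pSShat fst + ent pSShat snd - ent pSShat id) <=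
    n%:R * sl_infoUSZ PS PYZ q_code /\
  (1 - Pe) * log2 M%:R - 1 +
    n%:R * (ent pSShat fst + ent pSShat snd - ent pSShat id) <=
    n%:R * (sl_infoUSZ PS PYZ q_code + sl_infoXY PS PYZ q_code).
Proof.
have usz : n%:R * sl_infoUSZ PS PYZ q_code =
    n%:R * (- \sum_z eta (pZ z)) + \sum_(i < n) (Gam i - Phi i).
  rewrite mulrDr sum_homogeneous_q_code; last exact: kappa_homogeneous.
  rewrite {1}/ent law_q_codeZ; congr (_ + _).
  by apply: eq_bigr => i _; exact: sum_kappa_code.
have xy : n%:R * sl_infoXY PS PYZ q_code =
    \sum_(i < n) (Phi i.+1 - Gam i - eY i).
  rewrite sum_homogeneous_q_code; last exact: chi_homogeneous.
  by apply: eq_bigr => i _; exact: sum_chi_code.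
have tele (f : nat -> R) : \sum_(i < n) (f i.+1 - f i) = f n - f 0%N.
  by rewrite -(big_mkord xpredT (fun i => f i.+1 - f i)) telescope_sumr.
have rd := mutual_info_pSShat.
rewrite [X in _ /\ _ <= X]mulrDr usz xy; split.
  have : \sum_(i < n) (Psi i.+1 - Psi i) <= \sum_(i < n) (Gam i - Phi i).
    by apply: ler_sum => i _; exact: Psi_Gam.
  rewrite tele Psi0 Psin; lra.
(* When both informations are added, the terms [Gam i - Phi i] cancel, leaving increments of [Phi]
   and channel entropies. *)
have -> : \sum_(i < n) (Phi i.+1 - Gam i - eY i) =
    \sum_(i < n) (Phi i.+1 - Phi i) - \sum_(i < n) (Gam i - Phi i) -
    \sum_(i < n) eY i.
  by rewrite -!sumrB; apply: eq_bigr => i _; ring.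
rewrite tele Phi0 Phin.
have := fano; rewrite ent_msg_state_outY ent_msg_state; lra.
Qed.

End CodeConverse.

(** * Passage to the limit *)

Section EtaContinuous.
Variable R : realType.

(** Apply [ln y < y] at [y = 1 / sqrt x]. The bound tends to 0 with [x], which gives continuity of
    [eta] at 0. *)
Lemma eta_abs_le (x : R) : x < 1 -> `|eta x| <= 2 / ln 2 * Num.sqrt x.
Proof.
move=> x1; have [x0|x0] := leP x 0.
  by rewrite /eta /log2 ln0// mul0r mulr0 normr0 ler0_sqrtr// mulr0.
have s0 : 0 < Num.sqrt x by rewrite sqrtr_gt0.
have lnx : ln x <= 0 by rewrite ln_le0 ?ltW.
rewrite /eta /log2 mulrA normrM [X in _ * X]ger0_norm ?invr_ge0 ?(ltW (ln2_gt0 R))//.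
rewrite -mulrA [_^-1 * _]mulrC mulrA ler_pM2r ?invr_gt0 ?ln2_gt0//.
rewrite normrM (gtr0_norm x0) ler0_norm//.
have : ln (Num.sqrt x)^-1 < (Num.sqrt x)^-1 by apply: ln_sublinear; rewrite invr_gt0.
rewrite lnV ?posrE// => h.
have E : x = Num.sqrt x * Num.sqrt x by rewrite -expr2 sqr_sqrtr ?ltW.
rewrite {1 2}E lnM ?posrE// -mulrA [2 * _]mulrC ler_pM2l//.
rewrite -(ler_pM2l s0) in h *.
move: h; rewrite -(ltr_pM2l s0) divff ?gt_eqF//; nra.
Qed.

Lemma eta_continuous : continuous (@eta R).
Proof.
move=> x; have [x0|x0|->] := ltgtP x 0.
(* [ln] is 0 by convention on nonpositive arguments, so [eta] vanishes near a negative point. *)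
- have : (fun=> 0 : R) @ x --> (0 : R) by exact: cvg_cst.
  have ex : eta x = 0 by rewrite /eta /log2 ln0 ?ltW// mul0r mulr0.
  rewrite /continuous_at ex.
  apply: cvg_trans; apply: near_eq_cvg; near=> y.
  have y0 : y < 0 by near: y; exact: lt_nbhsl.
  by rewrite /eta /log2 ln0 ?ltW// mul0r mulr0.
- apply: continuousM => //; rewrite /log2; apply: continuousM.
    exact: continuous_ln.
  exact: cst_continuous.
- rewrite /continuous_at [X in _ --> X](_ : _ = 0); last by rewrite /eta mul0r.
  apply/cvgr0Pnorm_le => e e0.
  have : (fun y => 2 / ln 2 * Num.sqrt y) @ (0 : R) --> (2 / ln 2 * Num.sqrt 0 : R).
    by apply: cvgM; [exact: cvg_cst|exact: sqrt_continuous].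
  rewrite sqrtr0 mulr0 => /cvgr0Pnorm_le/(_ e e0) H.
  near=> y; have y1 : y < 1 by near: y; exact: lt_nbhsl.
  apply: (le_trans (eta_abs_le y1)); apply: le_trans (ler_norm _) _.
  by near: y.
Unshelve. all: by end_near. Qed.

End EtaContinuous.

(** * Continuity of entropies in the weights *)

Section RealContinuity.
Variables (R : realType) (V : topologicalType).
Implicit Types f g : V -> R.

Lemma contD f g : continuous f -> continuous g ->
  continuous (fun v => f v + g v).
Proof. by move=> cf cg x; apply: cvgD; [exact: cf|exact: cg]. Qed.

Lemma contM f g : continuous f -> continuous g ->
  continuous (fun v => f v * g v).
Proof. by move=> cf cg x; apply: cvgM; [exact: cf|exact: cg]. Qed.

Lemma contN f : continuous f -> continuous (fun v => - f v).
Proof. by move=> cf x; apply: cvgN; exact: cf. Qed.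

Lemma cont_cst (a : R) : continuous (fun _ : V => a).
Proof. by move=> x; apply: cvg_cst. Qed.

Lemma contB f g : continuous f -> continuous g ->
  continuous (fun v => f v - g v).
Proof. by move=> cf cg; apply: contD => //; apply: contN. Qed.

Lemma cont_norm f : continuous f -> continuous (fun v => `|f v|).
Proof. by move=> cf x; apply: cvg_norm; exact: cf. Qed.

Lemma cont_min f g : continuous f -> continuous g ->
  continuous (fun v => Num.min (f v) (g v)).
Proof. by move=> cf cg x; apply: continuous_min; [exact: cf|exact: cg]. Qed.

Lemma cont_sum (I : Type) (r : seq I) (Q : pred I) (F : I -> V -> R) :
  (forall i, continuous (F i)) -> continuous (fun v => \sum_(i <- r | Q i) F i v).
Proof.
move=> cF; elim: r => [|i r IH].
  by under eq_fun do rewrite big_nil; exact: cont_cst.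
under eq_fun do rewrite big_cons.
by case: (Q i) => //; exact: contD.
Qed.

Lemma cont_law (T A : finType) (F : V -> T -> R) (f : T -> A) a :
  (forall t, continuous (F^~ t)) -> continuous (fun v => law (F v) f a).
Proof. by move=> cF; exact: cont_sum. Qed.

Lemma cont_ent (T A : finType) (F : V -> T -> R) (f : T -> A) :
  (forall t, continuous (F^~ t)) -> continuous (fun v => ent (F v) f).
Proof.
move=> cF; apply: contN; apply: cont_sum => a x.
apply: (continuous_comp (f := fun v => law (F v) f a)); first exact: cont_law.
exact: eta_continuous.
Qed.

End RealContinuity.

Lemma limn_esup_le_near (R : realType) (u : nat -> R) (D e : R) : 0 < e ->
  (limn_esup (EFin \o u) <= D%:E)%E -> \forall n \near \oo, u n <= D + e.
Proof.
move=> e0 uD.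
have : (limn_esup (EFin \o u) < (D + e)%:E)%E.
  by rewrite (le_lt_trans uD)// lte_fin ltrDl.
rewrite /limn_esup /limf_esup => /ereal_inf_lt[_ [A nA <-]] uA.
apply: filterS nA => n An; rewrite -lee_fin; apply: le_trans (ltW uA).
by apply: ereal_sup_ubound; exists n.
Qed.

Lemma num_messages_ge (R : realType) (r : R) n :
  (0 < num_messages r n)%N /\ n%:R * r <= log2 (num_messages r n)%:R.
Proof.
have p0 : 0 < 2 `^ (n%:R * r) :> R by rewrite powR_gt0.
have c0 : 0 < Num.ceil (2 `^ (n%:R * r)) by rewrite -(ltr_int R) (lt_le_trans p0)// ceil_ge.
have E : (num_messages r n)%:R = (Num.ceil (2 `^ (n%:R * r)))%:~R :> R.
  by rewrite /num_messages natr_absz gtr0_norm.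
split; first by rewrite absz_gt0 gt_eqF.
rewrite E /log2 ler_pdivlMr ?ln2_gt0// -ln_powR ler_ln ?posrE ?ceil_ge//.
by rewrite ltr0z.
Qed.

(** * Bounding the alphabet and removing the slack *)

Section SingleLetterReduction.
Variables (R : realType) (X S Y Z Shat : finType).
Variables (PS : S -> R) (PYZ : X -> S -> Y * Z -> R) (d : S -> Shat -> R).
Hypotheses (hPS : is_pmf PS) (hPYZ : forall x s, is_pmf (PYZ x s)).

Let PS0 s : 0 <= PS s. Proof. exact: hPS.1. Qed.
Let PYZ0 x s yz : 0 <= PYZ x s yz. Proof. exact: (hPYZ x s).1. Qed.

Definition joint_info (J : S * Shat -> R) := ent J fst + ent J snd - ent J id.

(** The functionals indexed by [X + bool] are the values of the marginal of [X], together with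
    [kappa] and [chi]. Keeping the marginal keeps the term [H(Z)], which is not additive over
    [u]. *)
Lemma caratheodory_single_letter (U : finType) (q : U -> X -> R) :
  (forall u x, 0 <= q u x) ->
  exists q' : 'I_#|{: X + bool}| -> X -> R,
    [/\ forall u x, 0 <= q' u x,
        forall x, \sum_u q' u x = \sum_u q u x,
        sl_infoUSZ PS PYZ q' = sl_infoUSZ PS PYZ q &
        sl_infoXY PS PYZ q' = sl_infoXY PS PYZ q].
Proof.
move=> q0.
pose phi (w : X + bool) : (X -> R) -> R := match w with
  | inl x => fun p => p x
  | inr b => if b then kappa PS PYZ else chi PS PYZ end.
have hphi w : homogeneous (phi w).
  case: w => [x|[]]; [by []|exact: kappa_homogeneous|exact: chi_homogeneous].
have [q' [q'0 q'E]] := caratheodory hphi q0.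
have q'x x : \sum_u q' u x = \sum_u q u x := q'E (inl x).
exists q'; split=> //; last exact: (q'E (inr false)).
rewrite /sl_infoUSZ -(q'E (inr true)).
by congr (ent (slq _ _ _) _ + _); apply/funext.
Qed.

(** The slack [e] absorbs Fano's constant 1 after division by [n], the loss [Pe * r], and the excess
    of the distortion over its limit superior. *)
Lemma achievable_approx (r D e : R) : 0 <= r -> 0 < e ->
  achievable PS PYZ d r D ->
  exists (U : finType) (q : U -> X -> R) (J : S * Shat -> R),
    [/\ forall u x, 0 <= q u x, \sum_x \sum_u q u x = 1,
        forall a, 0 <= J a & law J fst = PS] /\
    [/\ joint_info J - e <= sl_infoUSZ PS PYZ q,
        r + joint_info J - e <= sl_infoUSZ PS PYZ q + sl_infoXY PS PYZ q &
        expect J (fun a => d a.1 a.2) <= D + e].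
Proof.
move=> r0 e0 [c [Pe0 distD]].
have distE := limn_esup_le_near e0 distD.
(* [Pe <= 1] allows [log2 M] to be replaced by [n * r] in Fano's bound; the other term yields
   [Pe * r <= e / 2], with [r + 1] positive even at [r = 0]. *)
pose b : R := Num.min 1 (e / 2 / (r + 1)).
have r1 : 0 < r + 1 by rewrite ltr_wpDl.
have b0 : 0 < b by rewrite lt_min ltr01 !divr_gt0.
have Pb : \forall n \near \oo, error_prob PS PYZ (c n) <= b.
  move/cvgr0Pnorm_le : Pe0 => /(_ b b0); apply: filterS => n.
  exact/le_trans/ler_norm.
(* [n >= 2 / e] makes Fano's additive 1 at most [n * (e / 2)]. *)
have [n [n0 ne Peb disn]] : exists n, [/\ (0 < n)%N, e^-1 * 2 <= n%:R,
    error_prob PS PYZ (c n) <= b & distortion PS PYZ d (c n) <= D + e].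
  near \oo => n; exists n; split.
  - by near: n; exact: nbhs_infty_gt.
  - by near: n; exact: nbhs_infty_ger.
  - by near: n.
  - by near: n.
have [M0 Mr] := num_messages_ge r n.
have nR : 0 < n%:R :> R by rewrite ltr0n.
exists _, (q_code PS PYZ (c n)), (pSShat PS PYZ (c n)); split; split.
- by move=> u x; exact: q_code_ge0.
- exact: sum_q_code.
- by move=> a; exact: pSShat_ge0.
- exact: pSShat_fst.
- have [h _] := code_converse hPS hPYZ (c n) M0 n0.
  by move: h; rewrite ler_pM2l// /joint_info; lra.
- have [_ h] := code_converse hPS hPYZ (c n) M0 n0.
  rewrite -(ler_pM2l nR); apply: le_trans h.
  move: Peb; rewrite le_min => /andP[Pe1 Peb].
  set Pe := error_prob _ _ _ in Pe1 Peb *.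
  have h1 : (1 - Pe) * (n%:R * r) <= (1 - Pe) * log2 (num_messages r n)%:R.
    by rewrite ler_wpM2l// subr_ge0.
  have h2 : Pe * r <= e / 2.
    have : Pe * r <= e / 2 / (r + 1) * r by rewrite ler_wpM2r.
    move/le_trans; apply; rewrite -mulrA ler_piMr ?divr_ge0 ?(ltW e0)//.
    by rewrite mulrC ler_pdivrMr// mul1r lerDl.
  have h3 : n%:R * (Pe * r) <= n%:R * (e / 2) by rewrite ler_pM2l.
  have h4 : 1 <= n%:R * (e / 2).
    by rewrite mulrA ler_pdivlMr// mul1r mulrC -ler_pdivrMl.
  rewrite -/(joint_info _); set I := joint_info _.
  have -> : n%:R * (r + I - e) = (1 - Pe) * (n%:R * r) + n%:R * (Pe * r) +
      n%:R * I - 2 * (n%:R * (e / 2)) by field.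
  move: h1 h3 h4; set a := _ * (n%:R * r); set a1 := _ * log2 _.
  by set a2 := n%:R * (Pe * r); set a3 := n%:R * (e / 2); lra.
- by rewrite pSShat_expect.
Unshelve. all: by end_near. Qed.

(** With an alphabet size independent of [e], all approximate solutions lie in one compact cube, and
    continuity yields an exact one. *)
Lemma achievable_attained (r D : R) : 0 <= r -> achievable PS PYZ d r D ->
  exists (U : finType) (q : U -> X -> R) (J : S * Shat -> R),
    [/\ forall u x, 0 <= q u x, \sum_x \sum_u q u x = 1,
        forall a, 0 <= J a & law J fst = PS] /\
    [/\ joint_info J <= sl_infoUSZ PS PYZ q,
        r + joint_info J <= sl_infoUSZ PS PYZ q + sl_infoXY PS PYZ q &
        expect J (fun a => d a.1 a.2) <= D].
Proof.
move=> r0 rD.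
pose U : finType := 'I_#|{: X + bool}|.
(* Both weights become coordinates of one row vector, so that compactness of a box applies to them
   jointly. *)
pose W : finType := (U * X + S * Shat)%type.
pose V := 'rV[R]_#|W|.
pose q (v : V) u x := v ord0 (enum_rank (inl (u, x) : W)).
pose J (v : V) a := v ord0 (enum_rank (inr a : W)).
(* [m] is the smallest slack of all constraints, the term [- gap] standing for
   the normalisation equalities; its maximum over the unit cube is at least
   [- e] for every [e > 0], hence nonnegative. *)
pose gap v := `|(\sum_x \sum_u q v u x) - 1| + \sum_s `|law (J v) fst s - PS s|.
pose m v := Num.min (sl_infoUSZ PS PYZ (q v) - joint_info (J v))
  (Num.min (sl_infoUSZ PS PYZ (q v) + sl_infoXY PS PYZ (q v) - (r + joint_info (J v)))
  (Num.min (D - expect (J v) (fun a => d a.1 a.2)) (- gap v))).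
have cq u x : continuous (fun v => q v u x) by exact: coord_continuous.
have cJ a : continuous (fun v => J v a) by exact: coord_continuous.
have cslq (p : V -> X -> R) : (forall x, continuous (p^~ x)) ->
    forall t, continuous (fun v => slq PS PYZ (p v) t).
  move=> cp [[[s x] y] z]; rewrite /slq.
  by do 2 (apply: contM; last exact: cont_cst).
have cUSZ : continuous (fun v => sl_infoUSZ PS PYZ (q v)).
  apply: contD; first by apply: cont_ent; apply: cslq => x; exact: cont_sum.
  by apply: cont_sum => u; apply: contB; apply: cont_ent; exact: cslq.
have cXY : continuous (fun v => sl_infoXY PS PYZ (q v)).
  apply: cont_sum => u; do 2 (apply: contB; last by apply: cont_ent; exact: cslq).
  by apply: contD; apply: cont_ent; exact: cslq.
have cI : continuous (fun v => joint_info (J v)).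
  apply: contB; last exact: cont_ent.
  by apply: contD; exact: cont_ent.
have cgap : continuous gap.
  apply: contD.
    apply: cont_norm; apply: contB; last exact: cont_cst.
    by apply: cont_sum => x; exact: cont_sum.
  apply: cont_sum => s; apply: cont_norm; apply: contB; last exact: cont_cst.
  exact: cont_law.
have cm : continuous m.
  apply: cont_min; first exact: contB.
  apply: cont_min.
    apply: contB; first exact: contD.
    by apply: contD => //; exact: cont_cst.
  apply: cont_min; last exact: contN.
  apply: contB; first exact: cont_cst.
  by apply: cont_sum => a; apply: contM => //; exact: cont_cst.
pose K : set V := [set v | forall i, `[0, 1]%classic (v ord0 i)].
have Kc : compact K.
  by apply: (@rV_compact R #|W| (fun=> `[0, 1]%classic)) => _; exact: segment_compact.
have approx e : 0 < e -> exists2 v, v \in K & - e <= m v.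
  move=> e0.
  have [U1 [q1 [J1 [[q10 q11 J10 J11] [h1 h2 h3]]]]] := achievable_approx r0 e0 rD.
  have [q2 [q20 q2x q2Z q2Y]] := caratheodory_single_letter q10.
  rewrite -q2Z in h1; rewrite -q2Z -q2Y in h2.
  pose v : V := \row_i match enum_val i with
    | inl ux => q2 ux.1 ux.2 | inr a => J1 a end.
  have qv : q v = q2.
    by apply/funext => u; apply/funext => x; rewrite /q mxE enum_rankK.
  have Jv : J v = J1 by apply/funext => a; rewrite /J mxE enum_rankK.
  have q21 : \sum_x \sum_u q2 u x = 1 by under eq_bigr do rewrite q2x.
  have J1s : \sum_a J1 a = 1 by rewrite -(sum_law J1 fst) J11 hPS.2.
  exists v.
    (* Each coordinate is one term of a nonnegative family with sum 1, hence lies in the unit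
       interval. *)
    rewrite inE => i /=; rewrite in_itv/= mxE; case: (enum_val i) => [[u x]|a]/=.
      rewrite q20/= -q21 (bigD1 x)//= (bigD1 u)//= -addrA lerDl addr_ge0//.
        exact: sumr_ge0.
      by apply: sumr_ge0 => x' _; exact: sumr_ge0.
    by rewrite J10/= -J1s (bigD1 a)//= lerDl sumr_ge0.
  rewrite /m /gap qv Jv q21 J11 subrr normr0 add0r.
  rewrite big1 ?oppr0; last by move=> s _; rewrite subrr normr0.
  rewrite !le_min; apply/and4P; split; lra.
have [v0 v0K _] := approx 1 ltr01.
have [|v vK vmax] := compact_EVT_max _ Kc (continuous_subspaceT cm).
  by exists v0; rewrite inE in v0K.
have : 0 <= m v.
  apply/ler_addgt0Pr => e e0; have [w wK mw] := approx e e0.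
  by have := vmax w wK; lra.
rewrite !le_min => /and4P[h1 h2 h3 h4].
have K0 i : 0 <= v ord0 i.
  by move: vK; rewrite inE => /(_ i)/=; rewrite in_itv/= => /andP[].
(* [gap v <= 0] while [gap] adds two nonnegative terms, so both normalisation conditions hold
   exactly. *)
have [g1 g2] : `|(\sum_x \sum_u q v u x) - 1| = 0 /\
    \sum_s `|law (J v) fst s - PS s| = 0.
  have : 0 <= \sum_s `|law (J v) fst s - PS s| by exact: sumr_ge0.
  have := normr_ge0 ((\sum_x \sum_u q v u x) - 1).
  by move: h4; rewrite /gap; split; lra.
exists U, (q v), (J v); split; split.
- by move=> u x; exact: K0.
- by apply/eqP; rewrite -subr_eq0 -normr_eq0 g1.
- by move=> a; exact: K0.
- apply/funext => s; apply/eqP; rewrite -subr_eq0 -normr_eq0.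
  by move/eqP: g2; rewrite psumr_eq0// => /allP/(_ s); rewrite mem_index_enum; exact.
- by lra.
- by lra.
- by lra.
Qed.

End SingleLetterReduction.

(** * The upper bound on the capacity-distortion function *)

Theorem theorem7 (R : realType) (X S Y Z Shat : finType)
    (PS : S -> R) (PYZ : X -> S -> Y * Z -> R) (d : S -> Shat -> R)
    (hPS : is_pmf PS)
    (hPYZ : forall (x : X) (s : S), is_pmf (PYZ x s))
    (hd : forall (s : S) (sh : Shat), 0 <= d s sh)
    (D : R) (hD : (Dmin PS PYZ d <= D%:E)%E) :
  (capacity_distortion PS PYZ d D <=
     ereal_sup [set v : \bar R |
       exists (U : finType) (PUX : U * X -> R),
         [/\ is_pmf PUX,
             rate_distortion PS d D <= (info_US_Z PS PYZ PUX)%:E &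
             v = (info_X_Y_given_US PS PYZ PUX + info_US_Z PS PYZ PUX)%:E]]
     - rate_distortion PS d D)%E.
Proof.
apply: ge_ereal_sup => _ [r [r0 rD] <-].
have [U [q [J [[q0 q1 J0 J1] [h1 h2 h3]]]]] :=
  achievable_attained hPS hPYZ r0 rD.
(* Conditioning [J] on the state gives a test channel that meets the distortion constraint. *)
have rdJ : (rate_distortion PS d D <= (joint_info J)%:E)%E.
  apply: ereal_inf_lbound.
  (* States with [PS s = 0] receive the marginal of the estimate, so that every row of [Q] is a pmf;
     [J] vanishes there, so the product is still [J]. *)
  pose Q s h := if PS s == 0 then law J snd h else J (s, h) / PS s.
  have PSE s : PS s = \sum_h J (s, h) by rewrite -J1 law_fst.
  have QJ : (fun '(s, h) => PS s * Q s h) = J.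
    apply/funext => -[s h]; rewrite /Q; case: eqP => [Ps|/eqP Ps]; last first.
      by rewrite mulrCA divff ?mulr1.
    rewrite Ps mul0r; apply/esym/eqP.
    have /eqP := PSE s; rewrite Ps eq_sym psumr_eq0// => /allP/(_ h).
    by rewrite mem_index_enum; exact.
  exists Q; split.
  - move=> s; split=> [h|].
      by rewrite /Q; case: ifP => _; [exact: law_ge0|rewrite divr_ge0// hPS.1].
    rewrite /Q; case: eqP => [_|/eqP Ps].
      by rewrite sum_law -(sum_law J fst) J1 hPS.2.
    by rewrite -mulr_suml -PSE divff.
  - rewrite QJ; apply: le_trans h3; rewrite le_eqVlt; apply/orP; left; apply/eqP.
    by apply: eq_bigr => -[].
  rewrite QJ mutual_infoE//; congr EFin; rewrite /joint_info; congr (_ + _ - _).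
pose PUX (ux : U * X) := q ux.1 ux.2.
have PUX0 ux : 0 <= PUX ux by exact: q0.
(* [PUX] is admissible because [R_S(D) <= joint_info J <= I(U,S;Z)]. *)
have feasible : (((sl_infoXY PS PYZ q + sl_infoUSZ PS PYZ q)%:E <=
  ereal_sup [set v : \bar R |
       exists (U : finType) (PUX : U * X -> R),
         [/\ is_pmf PUX,
             rate_distortion PS d D <= (info_US_Z PS PYZ PUX)%:E &
             v = (info_X_Y_given_US PS PYZ PUX + info_US_Z PS PYZ PUX)%:E]])%E).
  apply: ereal_sup_ubound; exists U, PUX; split.
  - by split=> //; rewrite sum_prod exchange_big.
  - by rewrite info_US_ZE; [apply: le_trans rdJ _; rewrite lee_fin
      |exact: hPS.1|move=> x s; exact: (hPYZ x s).1|].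
  - rewrite info_US_ZE; [rewrite info_X_YE|..]; rewrite //; try exact: hPS.1;
      by move=> x s; exact: (hPYZ x s).1.
(* [r] is at most the sum of the two informations minus [joint_info J]; replacing the latter by the
   smaller [R_S(D)] only weakens the bound. *)
apply: le_trans (leeB feasible rdJ).
by rewrite -EFinB lee_fin; lra.
Qed.
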